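(* Let $s\ge2$ be an integer and let $G_n^{5,s}$ be the graph obtained by taking $n$ disjoint copies of the complete graph $K_s$, choosing two distinct vertices $v_{i,1},v_{i,2}$ in the $i$-th copy, and adding the edges $v_{i,2}v_{i+1,1}$ for $i=1,\dots,n-1$. Let $f(m)$ be the number of maximal matchings of $K_m$, i.e. $f(m)=m!!$ for $m$ odd and $f(m)=(m-1)!!$ for $m$ even ($f(0)=1$). If $s\ge3$ is odd, then $$\lim_{n\to\infty}\mathcal{I}(G_n^{5,s})=\frac{r^2\frac{s^2-1}{2}f(s-2)-r(s^2-s-1)f(s-2)^2+\frac{3(s-1)}{2}f(s-2)^3}{\frac{s}{2}\big(r^2(s+1)f(s-2)-2rsf(s-2)^2+3f(s-2)^3\big)},$$ where $r$ is the root of maximum modulus of $x^3-(s+1)f(s-2)x^2+sf(s-2)^2x-f(s-2)^3=0$. If $s\ge2$ is even, then $$\lim_{n\to\infty}\mathcal{I}(G_n^{5,s})=\frac{r^2\frac{s^2}{2}f(s-2)+rs(s-1)(s-3)f(s-2)^2+\frac{3s^2-5s+2}{2}f(s-2)^3}{\frac{s}{2}\big(r^2sf(s-2)+2r(s^2-3s+1)f(s-2)^2+3(s-1)f(s-2)^3\big)},$$ where $r$ is the root of maximum modulus of $x^3-sf(s-2)x^2-(s^2-3s+1)f(s-2)^2x-(s-1)f(s-2)^3=0$.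
   Context: For a finite simple graph $G$: a matching is a set of pairwise vertex-disjoint edges; it is maximal if not contained in a larger matching. $\nu(G)$ is the maximum matching size, $\mathcal{T}_0(G)$ the number of maximal matchings, $\mathcal{T}_1(G)$ the sum of the sizes of all maximal matchings, and $\mathcal{I}(G)=\frac{\mathcal{T}_1(G)}{\nu(G)\mathcal{T}_0(G)}$ (equal to $1$ by convention if $\nu(G)=0$). For odd $m$, $m!!=\prod_{k=0}^{(m-1)/2}(m-2k)$. *)

(* Defs.v *)
From HB Require Import structures.
From mathcomp Require Import all_boot all_order all_algebra.
From mathcomp Require Import complex.
From mathcomp Require Import reals.

Set Implicit Arguments.
Unset Strict Implicit.
Unset Printing Implicit Defensive.

Import Order.TTheory GRing.Theory Num.Theory.

Local Open Scope nat_scope.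

Record sgraph := SGraph {
  vertex :> finType;
  adj : rel vertex;
  adj_sym : symmetric adj;
  adj_irr : irreflexive adj }.

Section Matchings.
Variable G : sgraph.

Definition edges : {set {set G}} :=
  [set [set p.1; p.2] | p in [pred p : G * G | adj p.1 p.2]].

Definition matching : pred {set {set G}} :=
  fun M => (M \subset edges) && trivIset M.

Definition maximal_matching : pred {set {set G}} :=
  fun M => maxset matching M.

Definition nu : nat := \max_(M | matching M) #|M|.

Definition T0 : nat := #|[set M | maximal_matching M]|.

Definition T1 : nat := \sum_(M | maximal_matching M) #|M|.

Definition calI (R : realType) : R :=
  (if nu == 0%N then 1 else T1%:R / (nu%:R * T0%:R))%R.

End Matchings.

Section Complete.
Variable m : nat.

Definition complete_adj : rel 'I_m := fun x y => x != y.

Lemma complete_adj_sym : symmetric complete_adj.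
Proof. by move=> x y; rewrite /complete_adj eq_sym. Qed.

Lemma complete_adj_irr : irreflexive complete_adj.
Proof. by move=> x; rewrite /complete_adj eqxx. Qed.

Definition complete_graph : sgraph := SGraph complete_adj_sym complete_adj_irr.

End Complete.

(* Vertex (i, a) is vertex a of the i-th copy of K_s (copies are numbered from
   0); v1 i and v2 i are the two chosen vertices of the i-th copy. *)
Section Chain.
Variables (n s : nat) (v1 v2 : 'I_n -> 'I_s).

Definition chain_link : rel ('I_n * 'I_s) := fun x y =>
  [&& x.1.+1 == y.1 :> nat, x.2 == v2 x.1 & y.2 == v1 y.1].

Definition chain_adj : rel ('I_n * 'I_s) := fun x y =>
  [|| (x.1 == y.1) && (x.2 != y.2), chain_link x y | chain_link y x].

Lemma chain_adj_sym : symmetric chain_adj.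
Proof.
move=> x y; rewrite /chain_adj (eq_sym y.1) (eq_sym y.2).
by rewrite (orbC (chain_link x y)).
Qed.

Lemma chain_adj_irr : irreflexive chain_adj.
Proof.
by move=> x; rewrite /chain_adj /chain_link !eqxx (gtn_eqF (ltnSn _)).
Qed.

Definition chain_graph : sgraph := SGraph chain_adj_sym chain_adj_irr.

End Chain.

(* Intended for odd m only *)
Definition dfact (m : nat) : nat := \prod_(0 <= k < (m.-1)./2.+1) (m - 2 * k).

Definition f (m : nat) : nat := T0 (complete_graph m).

(* Strictness makes such an r unique: "the" root of maximum modulus over C *)
Definition max_modulus_root (R : realType) (p : {poly R}) (r : R[i]) : Prop :=
  let pC := map_poly (real_complex R) p in
  (root pC r /\
   forall z : R[i], root pC z -> z != r -> `|z| < `|r|)%R.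

(* Main.v *)
(** A maximal matching of the chain is determined by its traces on the copies of
K_s, and consecutive traces interact only through the state of the link between
them: used, or unused with left end covered, or unused with left end exposed.
A copy has at most one exposed vertex, so for each pair of states the number of
compatible traces is an explicit multiple of F = f (s - 2), and T0 and T1 are
computed by a 3x3 transfer matrix whose characteristic polynomial is the cubic
of the theorem; T1 satisfies the differentiated recurrence. If r is the dominant
root, the quadratic cofactor of X - r, rescaled by r, has coefficients b, c with
|b| + |c| < 1. Hence T0 / r^n and the increments of T1 / r^n converge, and
Cesaro's lemma gives the limit of T1 / (n T0). Since n s - 1 <= 2 nu <= n s, the
limit of I follows. *)

Require Import Defs.
From HB Require Import structures.
From mathcomp Require Import all_boot all_order all_algebra.
From mathcomp Require Import complex.
From mathcomp Require Import ring lra zify.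

Set Implicit Arguments.
Unset Strict Implicit.
Unset Printing Implicit Defensive.

Import Order.TTheory GRing.Theory Num.Theory.

(** * Matchings and maximal matchings *)

(** The source term in the recurrence of T1 comes from a weighted transfer matrix. Give each
    transition the factor y^k, where k is the number of vertices of the copy that are covered. The
    characteristic coefficients e_i become polynomials in y, and differentiating the recurrence of
    the generating polynomials at y = 1 yields the source coefficients g_i = e_i'(1). Counting
    covered vertices instead of edges makes the weight local: a link contributes one vertex to each
    of its two copies, and by parity the number of covered vertices of a copy depends only on which
    of its two links are used. The totals are then 2 T1, whence the halves in the numerators. The
    inequality on b and c has a second use: it bounds the modulus of every other complex root, so
    the quadratic is never solved. It is checked after the substitution r = F x, which leaves a
    cubic depending on s alone, whose root x is enclosed by the intermediate value theorem. *)

Section Pairsets.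
Variable V : finType.
Implicit Types (x y z : V) (r : rel V).

Lemma set2_inj x y x' y' : [set x; y] = [set x'; y'] ->
  (x = x' /\ y = y') \/ (x = y' /\ y = x').
Proof.
move=> e.
have := set21 x y; rewrite e !inE => /orP[] /eqP ex; [left|right]; split=> //.
- have := set22 x y; rewrite e !inE => /orP[] /eqP // ey.
  by have := set22 x' y'; rewrite -e !inE ex ey orbb => /eqP.
- have := set22 x y; rewrite e !inE => /orP[] /eqP // ey.
  by have := set21 x' y'; rewrite -e !inE ex ey orbb => /eqP.
Qed.

Definition pairset r : {set {set V}} :=
  [set [set p.1; p.2] | p in [pred p : V * V | r p.1 p.2]].

Lemma pairsetP r e :
  reflect (exists x y, r x y /\ e = [set x; y]) (e \in pairset r).
Proof.
apply: (iffP imsetP) => [[[x y] /= rxy ->]|[x [y [rxy ->]]]]; first by exists x, y.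
by exists (x, y).
Qed.

Lemma in_pairset r x y : symmetric r -> ([set x; y] \in pairset r) = r x y.
Proof.
move=> rC; apply/pairsetP/idP => [[x' [y' [rxy]]]|rxy]; last by exists x, y.
by case/set2_inj => -[-> ->] //; rewrite rC.
Qed.

End Pairsets.

Section GraphMatchings.
Variable G : sgraph.
Implicit Types (x y z : G) (M N : {set {set G}}).

Lemma edgesP (e : {set G}) :
  reflect (exists x y, adj x y /\ e = [set x; y]) (e \in edges G).
Proof. exact: pairsetP. Qed.

Lemma in_edges x y : ([set x; y] \in edges G) = adj x y.
Proof. exact/in_pairset/adj_sym. Qed.

Lemma edge_set_ext M N : M \subset edges G -> N \subset edges G ->
  (forall x y, adj x y -> ([set x; y] \in M) = ([set x; y] \in N)) -> M = N.
Proof.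
move=> /subsetP ME /subsetP NE eMN; apply/setP=> e.
case eE: (e \in edges G); first by case/edgesP: eE => x [y [xy ->]]; exact: eMN.
by rewrite (contraFF (ME e) eE) (contraFF (NE e) eE).
Qed.

Lemma mem_coverP M x : M \subset edges G ->
  reflect (exists y, [set x; y] \in M) (x \in cover M).
Proof.
move=> /subsetP ME; apply: (iffP bigcupP) => [[e eM xe]|[y xyM]]; last first.
  by exists [set x; y] => //; rewrite set21.
have eE := ME e eM; case/edgesP: eE xe eM => a [b [ab ->]]; rewrite !inE => /orP[] /eqP->.
  by exists b.
by rewrite setUC; exists a.
Qed.

Lemma matchingP M :
  reflect (M \subset edges G /\
           forall x y z, [set x; y] \in M -> [set x; z] \in M -> y = z)
          (matching M).
Proof.
apply: (iffP andP) => -[ME MM]; split=> //.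
  move=> x y z xy xz; move/trivIsetP: MM => /(_ _ _ xy xz).
  case: eqP => [e _|_ /(_ isT)]; last first.
    by rewrite -setI_eq0 => /eqP/setP/(_ x); rewrite !inE eqxx.
  by case/set2_inj: e => -[? ?]; congruence.
apply/trivIsetP => A B AM BM; apply: contraNT => AB.
move/pred0Pn: AB => [x /= /andP[xA xB]].
have aux E : E \in M -> x \in E -> exists y, E = [set x; y].
  move=> EM; case/edgesP: (subsetP ME _ EM) => a [b [_ ->]].
  rewrite !inE => /orP[] /eqP->; first by exists b.
  by exists a; rewrite setUC.
case: (aux A AM xA) (aux B BM xB) => [y eA] [z eB]; subst A B.
by rewrite (MM _ _ _ AM BM).
Qed.

Lemma matching_sub M : matching M -> M \subset edges G.
Proof. by case/andP. Qed.

Lemma card_edge (e : {set G}) : e \in edges G -> #|e| = 2.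
Proof.
case/edgesP => x [y [xy ->]]; rewrite cards2.
by case: eqP xy => // ->; rewrite adj_irr.
Qed.

Lemma card_cover_matching M : matching M -> #|cover M| = #|M|.*2.
Proof.
case/andP=> /subsetP ME; rewrite /trivIset => /eqP <-.
rewrite (eq_bigr (fun=> 2)); first by rewrite sum_nat_const muln2.
by move=> e eM; apply: card_edge; exact: ME.
Qed.

(** A matching can be enlarged exactly when some edge has both ends uncovered. This makes maximality
    a condition on single edges, which can be checked copy by copy. *)
Lemma maximal_matchingP M :
  reflect (matching M /\
           forall x y, adj x y -> (x \in cover M) || (y \in cover M))
          (maximal_matching M).
Proof.
apply: (iffP maxsetP) => -[MM maxM]; split=> //; last first.
  move=> N NM sMN.
  apply/eqP; rewrite eqEsubset sMN andbT; apply/subsetP=> e eN.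
  have NE := matching_sub NM; have ME := matching_sub MM.
  case/matchingP: NM => _ NM.
  (* An edge of [N] that touches an edge of [M] coincides with it, because both belong to the
     matching [N]. *)
  have cov x y : [set x; y] \in N -> x \in cover M -> [set x; y] \in M.
    by move=> xyN /(mem_coverP _ ME)[z xz]; rewrite (NM _ _ _ xyN (subsetP sMN _ xz)).
  have eE := subsetP NE _ eN; case/edgesP: eE eN => x [y [xy ->]] eN.
  case/orP: (maxM _ _ xy); first exact: cov.
  by move: eN; rewrite setUC; exact: cov.
move=> x y xy.
apply: contraT; rewrite negb_or => /andP[xM yM].
have ME := matching_sub MM.
suff: matching ([set x; y] |: M).
  move/maxM => /(_ (subsetUr _ _)) e.
  by case/mem_coverP: xM => //; exists y; rewrite -e setU11.
have nM z z' : [set z; z'] \in M -> z != x /\ z != y.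
  move=> zM; suff zc: z \in cover M.
    by split; [apply: contraNneq xM|apply: contraNneq yM] => <-.
  by apply/mem_coverP => //; exists z'.
case/matchingP: MM => _ MM.
apply/matchingP; split=> [|a b c].
  by rewrite subUset ME andbT sub1set in_edges.
rewrite !in_setU1 => /orP[/eqP /set2_inj e1|abM] /orP[/eqP /set2_inj e2|acM].
- by case: e1 e2 => -[? ?] [] [? ?]; subst.
- by case: (nM _ _ acM) => /eqP ? /eqP ?; case: e1 => -[? ?]; subst.
- by case: (nM _ _ abM) => /eqP ? /eqP ?; case: e2 => -[? ?]; subst.
- exact: MM abM acM.
Qed.

End GraphMatchings.

(** * Perfect and near-perfect matchings of complete graphs *)

Fixpoint npairings (n : nat) : nat :=
  match n with 0 => 1 | 1 => 0 | (m.+1 as p).+1 => p * npairings m end.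

Lemma npairingsSS n : npairings n.+2 = n.+1 * npairings n.
Proof. by []. Qed.

Lemma npairings_odd n : odd n -> npairings n = 0.
Proof.
elim/ltn_ind: n => -[|[|n]] // IH; rewrite [odd _]/= negbK => on.
by rewrite npairingsSS IH ?muln0.
Qed.

Lemma npairings_gt0 n : ~~ odd n -> 0 < npairings n.
Proof.
elim/ltn_ind: n => -[|[|n]] // IH; rewrite [odd _]/= negbK => on.
by rewrite npairingsSS muln_gt0 IH.
Qed.

Section CompleteMatchings.
Variable m : nat.
Local Notation K := (complete_graph m).
Implicit Types (D Y : {set K}) (P : {set {set K}}).

Definition pairings D := [set P : {set {set K}} | matching P & cover P == D].

Lemma adj_complete (x y : K) : adj x y = (x != y). Proof. by []. Qed.

Lemma card_pairings_with (D : {set K}) (x y : K) :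
  x \in D -> y \in D :\ x ->
  #|[set P in pairings D | [set x; y] \in P]| = #|pairings (D :\ x :\ y)|.
Proof.
move=> xD yD; have yx : y != x by case/setD1P: yD.
pose h (P : {set {set K}}) := [set x; y] |: P.
have cov0 P : P \in pairings (D :\ x :\ y) -> [set x; y] \notin P.
  rewrite inE => /andP[MP /eqP cP]; apply: contraT => /negPn xyP.
  have: x \in cover P by apply/(mem_coverP _ (matching_sub MP)); exists y.
  by rewrite cP !inE eqxx andbF.
rewrite -(@card_in_imset _ _ h (pairings (D :\ x :\ y))); last first.
  move=> P Q /cov0 xP /cov0 xQ /= e.
  by rewrite -(setU1K xP) -(setU1K xQ) -/(h P) -/(h Q) e.
congr #|pred_of_set _|; apply/setP => P; apply/idP/imsetP.
  rewrite !inE => /andP[/andP[MP /eqP cP] xyP].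
  exists (P :\ [set x; y]); last by rewrite /h setD1K.
  have [PE /= PM] := matchingP _ MP.
  have SE : P :\ [set x; y] \subset edges K by apply: subset_trans (subsetDl _ _) PE.
  have MS : matching (P :\ [set x; y]).
    apply/matchingP; split=> // a b c; rewrite !inE => /andP[_ ab] /andP[_ ac].
    exact: PM ab ac.
  rewrite inE MS /=; apply/eqP/setP => z; apply/(mem_coverP _ SE)/idP.
    move=> [w]; rewrite !inE => /andP[zw zwP].
    rewrite -cP; apply/and3P; split; last by apply/(mem_coverP _ PE); exists w.
    - apply: contraNneq zw => ez; rewrite ez in zwP *.
      by rewrite setUC in xyP; rewrite (PM _ _ _ zwP xyP) setUC.
    - apply: contraNneq zw => ez; rewrite ez in zwP *.
      by rewrite (PM _ _ _ zwP xyP).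
  rewrite !inE -cP => /and3P[zy zx /(mem_coverP _ PE)[w zwP]].
  exists w; rewrite !inE zwP andbT; apply/eqP => /set2_inj[] [e _].
    by rewrite e eqxx in zx.
  by rewrite e eqxx in zy.
move=> [Q QD ->]; have xyQ := cov0 _ QD; move: QD; rewrite !inE eqxx andbT.
move=> /andP[/matchingP[QE MQ] /eqP cQ].
have nQ z z' : [set z; z'] \in Q -> z != y /\ z != x.
  move=> zQ; have: z \in cover Q by apply/(mem_coverP _ QE); exists z'.
  by rewrite cQ !inE => /and3P[].
apply/andP; split.
  apply/matchingP; split=> [|a b c].
    by rewrite subUset QE andbT sub1set in_edges adj_complete eq_sym.
  rewrite !in_setU1 => /orP[/eqP /set2_inj e1|abM] /orP[/eqP /set2_inj e2|acM].
  - by case: e1 e2 => -[? ?] [] [? ?]; subst.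
  - by case: (nQ _ _ acM) => /eqP ? /eqP ?; case: e1 => -[? ?]; subst.
  - by case: (nQ _ _ abM) => /eqP ? /eqP ?; case: e2 => -[? ?]; subst.
  - exact: MQ abM acM.
rewrite /cover /h big_setU1 //= -/(cover Q) cQ; apply/eqP/setP=> z; rewrite !inE.
case: (eqVneq z x) => [->|_] /=; first by rewrite xD.
by case: (eqVneq z y) => [->|] //=; case/setD1P: yD.
Qed.

(** Sorting the pairings by the partner of a fixed vertex [x] reproduces the recursion of
    [npairings], which is (n-1)!! for even n and 0 for odd n. *)
Lemma card_pairings D : #|pairings D| = npairings #|D|.
Proof.
move: {2}#|D| (erefl #|D|) => n; elim/ltn_ind: n D => n IH D eD; rewrite eD.
case: (set_0Vmem D) => [D0|[x xD]].
  move: eD; rewrite D0 cards0 => <- /=; apply/eqP/cards1P; exists set0.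
  apply/setP=> P; rewrite !inE; apply/andP/eqP => [[MP /eqP cP]|->].
    apply/eqP; rewrite -cards_eq0 -double_eq0 -(card_cover_matching MP) cP.
    by rewrite cards0.
  split; first by apply/matchingP; split=> [|a b c]; rewrite ?sub0set ?inE.
  by rewrite /cover big_set0.
transitivity (\sum_(y in D :\ x) #|[set P in pairings D | [set x; y] \in P]|).
  under [RHS]eq_bigr do rewrite -sum1dep_card big_mkcondr /=.
  rewrite exchange_big /= -sum1_card; apply: eq_bigr => P.
  rewrite inE => /andP[MP /eqP cP].
  have [PE /= PM] := matchingP _ MP.
  have: x \in cover P by rewrite cP.
  case/(mem_coverP _ PE) => y xyP.
  have yx : y != x by have := subsetP PE _ xyP; rewrite in_edges adj_complete eq_sym.
  have yD : y \in D.
    by rewrite -cP; apply/(mem_coverP _ PE); exists x; rewrite setUC.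
  rewrite (bigD1 y) ?inE ?yx //= xyP big1 // => z /andP[_ zy].
  by case: ifP => // xz; rewrite (PM _ _ _ xyP xz) eqxx in zy.
have Dx : #|D :\ x| = n.-1 by rewrite -eD (cardsD1 x D) xD.
have n0 : 0 < n by rewrite -eD card_gt0; apply/set0Pn; exists x.
transitivity (\sum_(y in D :\ x) npairings (n - 2)).
  apply: eq_bigr => y yD; rewrite (card_pairings_with xD yD).
  have Dxy : #|D :\ x :\ y| = n - 2.
    by have := cardsD1 y (D :\ x); rewrite yD Dx; lia.
  by rewrite (IH (n - 2)) ?Dxy //; lia.
rewrite sum_nat_const Dx; case: n n0 {IH eD Dx} => [|[|n]] // _.
by rewrite subSS subSS subn0.
Qed.

(** [Y] holds the vertices that may stay uncovered; in a copy of the chain the states of the two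
    links restrict them. *)
Definition near_pairings D Y := [set P : {set {set K}} |
  [&& matching P, cover P \subset D, #|D :\: cover P| <= 1
    & D :\: cover P \subset Y]].

Definition near_count (d y : nat) : nat :=
  if odd d then y * npairings d.-1 else npairings d.

(** A matching covers an even number of vertices, so the parity of [D] decides between one exposed
    vertex and none. *)
Lemma odd_near P D : matching P -> cover P \subset D ->
  #|D :\: cover P| <= 1 -> #|D :\: cover P| = odd #|D|.
Proof.
move=> MP cPD le1; have := card_cover_matching MP.
have := cardsD D (cover P); rewrite (setIidPr cPD).
have := subset_leq_card cPD; lia.
Qed.

Lemma cover_eq_setD P D (X : {set K}) : cover P \subset D -> X \subset D ->
  (cover P == D :\: X) = (D :\: cover P == X).
Proof.
by move=> cP XD; apply/eqP/eqP => [->|<-];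
  rewrite setDDr setDv set0U; [|symmetry]; exact/setIidPr.
Qed.

Lemma card_near_pairings D Y : Y \subset D ->
  #|near_pairings D Y| = near_count #|D| #|Y|.
Proof.
move=> YD; rewrite /near_count; case: ifP => oD.
  transitivity (\sum_(y in Y) #|pairings (D :\ y)|).
    under eq_bigr do rewrite -sum1dep_card big_mkcond /=.
    rewrite exchange_big /= -sum1_card big_mkcond /=; apply: eq_bigr => P _.
    rewrite inE; case MP: (@matching K P) => /=; last by rewrite big1.
    case: ifP => [/and3P[cPD le1 sY]|nP].
      have := odd_near MP cPD le1; rewrite oD => /eqP/cards1P[y ey].
      have yY : y \in Y by move: sY; rewrite ey sub1set.
      rewrite (bigD1 y) //= cover_eq_setD ?sub1set ?(subsetP YD) // ey eqxx.
      rewrite big1 // => z /andP[zY zy].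
      rewrite cover_eq_setD ?sub1set ?(subsetP YD) // ey.
      by case: eqP => // /set1_inj e; rewrite e eqxx in zy.
    rewrite big1 // => y yY; case: eqP => // cP.
    have cPD : cover P \subset D by rewrite cP subsetDl.
    move: nP; rewrite cPD; move/eqP: cP.
    rewrite cover_eq_setD ?sub1set ?(subsetP YD) // => /eqP ->.
    by rewrite cards1 sub1set yY.
  rewrite -sum_nat_const; apply: eq_bigr => y yY; rewrite card_pairings.
  by rewrite (cardsD1 y D) (subsetP YD).
rewrite -card_pairings; congr #|pred_of_set _|; apply/setP => P; rewrite !inE.
case MP: (matching P) => //=; apply/and3P/eqP => [[cPD le1 _]|->]; last first.
  by rewrite setDv cards0 sub0set.
have /eqP := odd_near MP cPD le1; rewrite oD cards_eq0 setD_eq0 => DcP.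
by apply/eqP; rewrite eqEsubset cPD.
Qed.

(** Any two vertices are adjacent, so maximality means at most one uncovered vertex. *)
Lemma T0_complete : T0 K = near_count m m.
Proof.
rewrite -[m in near_count m]card_ord -[X in near_count _ X]card_ord -!cardsT.
rewrite -card_near_pairings //; congr #|pred_of_set _|; apply/setP => P.
rewrite !inE; apply/maximal_matchingP/and4P => [[MP mP]|[MP _ le1 _]]; split=> //.
- apply/card_le1P => x; rewrite !inE andbT => xP y; rewrite !inE andbT.
  apply/idP/eqP => [yP|->//]; apply/eqP; rewrite eq_sym; apply: contraT => xy.
  by have := mP _ _ xy; rewrite (negbTE xP) (negbTE yP).
- move=> x y xy; apply: contraT; rewrite negb_or => /andP[xP yP].
  move/card_le1_eqP: le1 => /(_ x y).
  by rewrite !inE xP yP => /(_ isT isT) e; rewrite e adj_irr in xy.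
Qed.

End CompleteMatchings.

Lemma fE m : f m = near_count m m.
Proof. exact: T0_complete. Qed.

Lemma dfactSS k : dfact k.*2.+3 = k.*2.+3 * dfact k.*2.+1.
Proof.
rewrite /dfact big_nat_recl //= muln0 subn0; congr (_ * _).
rewrite !doubleK; apply: eq_bigr => i _; lia.
Qed.

Lemma npairings_double k : npairings k.+1.*2 = dfact k.*2.+1.
Proof.
elim: k => [|k IH]; first by rewrite /dfact big_nat1.
by rewrite doubleS npairingsSS IH doubleS dfactSS.
Qed.

Lemma f_odd m : odd m -> f m = dfact m.
Proof.
move=> om; rewrite fE /near_count om.
rewrite -[m]odd_double_half om add1n /=; move: (m./2) => [|k].
  by rewrite /dfact big_nat1.
by rewrite npairings_double -dfactSS.
Qed.

Lemma f_even m : ~~ odd m -> 0 < m -> f m = dfact (m - 1).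
Proof.
move=> om m0; rewrite fE /near_count (negbTE om).
have e : m = m./2.-1.+1.*2 by move: om m0; lia.
rewrite e; move: m./2.-1 => k.
by rewrite npairings_double doubleS subn1.
Qed.

(** * Transfer matrix *)

(* The trace of a matching on one copy of K_s: its edges inside the copy, and
   whether it contains the link to the next copy. *)
Notation config s := ({set {set complete_graph s}} * bool)%type.

(* The state of a link: [None] if it belongs to the matching, and otherwise
   [Some m], where [m] tells whether its left end is covered. *)
Notation state := (option bool).

Section Local.
Variables (s : nat) (a b : complete_graph s).
Hypothesis ab : a != b.
Implicit Types (q : state) (c : config s).

Definition next_state c : state := if c.2 then None else Some (b \in cover c.1).

Definition avail q (e : bool) : {set complete_graph s} :=
  ~: ((if q is None then [set a] else set0) :|: (if e then [set b] else set0)).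

Definition exposed q c := avail q c.2 :\: cover c.1.

Definition admissible q c :=
  [&& matching c.1, cover c.1 \subset avail q c.2, #|exposed q c| <= 1
    & (q == Some false) ==> (a \notin exposed q c)].

Lemma card_avail q e : #|avail q e| = s - (q == None) - e.
Proof.
rewrite cardsCs setCK card_ord; case: q => [q|]; case: e => /=;
  rewrite ?setU0 ?set0U ?cards0 ?cards1 ?subn0 //.
by rewrite cards2 ab; lia.
Qed.

Lemma card_exposed q c : admissible q c ->
  #|exposed q c| = odd (s - (q == None) - c.2).
Proof.
by case/and4P => MP cP le1 _; rewrite /exposed (odd_near MP cP le1) card_avail.
Qed.

(** The incoming link leaves [d] vertices, and [w] records that [a] may not be the exposed one. A
    used outgoing link removes [b]; for [Some true], [b] is only barred from being exposed; for
    [Some false], [b] is the exposed vertex and the others are perfectly matched. *)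
Definition transitions q q' : nat :=
  let d := s - (q == None) in let w := q == Some false in
  match q' with
  | None => near_count d.-1 (d.-1 - w)
  | Some true => near_count d (d.-1 - w)
  | Some false => npairings d.-1
  end.

Lemma avail_b q : b \in avail q false.
Proof. by case: q => [q|]; rewrite !inE ?orbF // eq_sym. Qed.

Lemma avail_a q e : q != None -> a \in avail q e.
Proof. by case: q => // q _; case: e; rewrite !inE ?orbF ?ab. Qed.

Lemma card_transitions q q' :
  #|[set c | admissible q c & next_state c == q']| = transitions q q'.
Proof.
(* The target state determines the boolean component, so only the inner edge sets have to be
   counted. *)
have eqI (e : bool) (A : {set config s}) (S : {set {set {set complete_graph s}}}) :
    (forall P, ((P, e) \in A) = (P \in S)) -> (forall P, ((P, ~~ e) \in A) = false) ->
    #|A| = #|S|.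
  move=> A1 A2; rewrite -(@card_imset _ _ (fun P => (P, e)) (mem S)); last first.
    by move=> ? ? [].
  apply: eq_card => -[P e']; case: (eqVneq e' e) => [->|ne].
    rewrite A1; apply/idP/imsetP => [PS|[P' ? [->]]] //; by exists P.
  have -> : e' = ~~ e by case: (e') (e) ne => -[].
  by rewrite A2; apply/esym/imsetP => -[P' _ [_]]; case: (e).
pose Y q e := if q == Some false then avail q e :\ a else avail q e.
have cY q1 e : #|Y q1 e| = s - (q1 == None) - e - (q1 == Some false).
  rewrite /Y; case: eqP => [->|_]; last by rewrite card_avail subn0.
  by have := cardsD1 a (avail (Some false) e); rewrite avail_a // card_avail; lia.
have sY q1 e : Y q1 e \subset avail q1 e by rewrite /Y; case: ifP; rewrite ?subsetDl.
have YE q1 P e : ((q1 == Some false) ==> (a \notin exposed q1 (P, e))) =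
    (exposed q1 (P, e) \subset Y q1 e).
  rewrite /Y; case: eqP => _ /=; last by rewrite subsetDl.
  by rewrite subsetD1 subsetDl.
case: q' => [[]|]; rewrite /transitions.
- rewrite (eqI false _ (near_pairings (avail q false) (Y q false :\ b))).
  + rewrite card_near_pairings; last first.
      exact: subset_trans (subsetDl _ _) (sY _ _).
    rewrite card_avail subn0; congr near_count.
    have := cardsD1 b (Y q false); rewrite cY.
    have -> : b \in Y q false.
      by rewrite /Y; case: ifP => _; rewrite ?in_setD1 avail_b // eq_sym ab.
    lia.
  + move=> P; rewrite !inE /admissible /= YE /next_state /= -!andbA.
    congr [&& _, _, _ & _]; rewrite subsetD1; congr (_ && _).
    by rewrite inE avail_b andbT negbK; case: (b \in cover P).
  + by move=> P; rewrite inE /next_state /= andbF.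
- rewrite (eqI false _ (pairings (avail q false :\ b))).
  + rewrite card_pairings; have := cardsD1 b (avail q false).
    by rewrite avail_b card_avail subn0 add1n => ->.
  + move=> P; rewrite !inE /admissible /= YE /next_state /=.
    apply/andP/andP => [[/and4P[MP cP le1 sP] /eqP[bP]]|[MP /eqP cP]]; split=> //.
      rewrite cover_eq_setD ?sub1set ?avail_b // eq_sym eqEcard cards1.
      by rewrite sub1set inE avail_b bP.
    have cPD : cover P \subset avail q false by rewrite cP subsetDl.
    have := eqxx (cover P); rewrite {2}cP cover_eq_setD ?sub1set ?avail_b //.
    rewrite /exposed /= => /eqP ->; rewrite MP cPD cards1 sub1set /Y /=.
    by case: ifP => _; rewrite ?in_setD1 avail_b // eq_sym ab.
    by rewrite cP !inE eqxx.
  + by move=> P; rewrite inE /next_state /= andbF.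
- rewrite (eqI true _ (near_pairings (avail q true) (Y q true))).
  + by rewrite card_near_pairings // card_avail cY !subn1.
  + by move=> P; rewrite !inE /admissible /= YE /next_state /= andbT.
  + by move=> P; rewrite inE /next_state /= andbF.
Qed.

(** This is one row of a matrix-vector product: the summand sees the configuration only through its
    outgoing state. *)
Lemma sum_admissible q (F : config s -> nat) (H : state -> nat) :
  (forall c, admissible q c -> F c = H (next_state c)) ->
  \sum_(c | admissible q c) F c =
    transitions q None * H None + transitions q (Some true) * H (Some true)
    + transitions q (Some false) * H (Some false).
Proof.
move=> FH; rewrite -!card_transitions.
have part q' : #|[set c | admissible q c & next_state c == q']| * H q' =
    \sum_(c | admissible q c && (next_state c == q')) F c.
  rewrite -sum_nat_const; apply: eq_big => [c|c]; rewrite inE // => /andP[ac /eqP e].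
  by rewrite FH // e.
rewrite !part (bigID (fun c => next_state c == None)) /= -addnA; congr (_ + _).
rewrite (bigID (fun c => next_state c == Some true)) /=; congr (_ + _);
  apply: eq_bigl => c; rewrite -andbA; congr (_ && _);
  by case: (next_state c) => [[]|].
Qed.

End Local.

(** * Counting sequences of configurations by the transfer matrix *)

Section Transfer.
Variables (s : nat) (v w : nat -> complete_graph s).
Hypothesis vw : forall k, v k != w k.
Implicit Types (q : state) (c : config s) (t : seq (config s)).

(** The base case rules out a link leaving the last copy. *)
Fixpoint valid k q t : bool :=
  if t is c :: t' then admissible (v k) (w k) q c && valid k.+1 (next_state (w k) c) t'
  else q != None.

(* Weights count covered vertices, that is, twice the number of edges. *)
Fixpoint covered k q t : nat :=
  if t is c :: t' then s - #|exposed (v k) (w k) q c| + covered k.+1 (next_state (w k) c) t'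
  else 0.

(** By [card_exposed], a copy has an exposed vertex exactly when its links leave an odd number of
    vertices. *)
Definition copy_weight q q' : nat := s - odd (s - (q == None) - (q' == None)).

(** The chosen vertices [v k] and [w k] have dropped out, so the counts depend on [s] and [n]
    alone. *)
Fixpoint count_vec n q : nat :=
  if n is n'.+1 then
    let g q' := transitions s q q' * count_vec n' q' in
    g None + g (Some true) + g (Some false)
  else q != None.

Fixpoint weight_vec n q : nat :=
  if n is n'.+1 then
    let g q' := transitions s q q' *
      (copy_weight q q' * count_vec n' q' + weight_vec n' q') in
    g None + g (Some true) + g (Some false)
  else 0.

Lemma count_vecS n q : count_vec n.+1 q =
  transitions s q None * count_vec n None
  + transitions s q (Some true) * count_vec n (Some true)
  + transitions s q (Some false) * count_vec n (Some false).
Proof. by []. Qed.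

Lemma weight_vecS n q : weight_vec n.+1 q =
  transitions s q None *
    (copy_weight q None * count_vec n None + weight_vec n None)
  + transitions s q (Some true) *
    (copy_weight q (Some true) * count_vec n (Some true) + weight_vec n (Some true))
  + transitions s q (Some false) *
    (copy_weight q (Some false) * count_vec n (Some false) + weight_vec n (Some false)).
Proof. by []. Qed.

Lemma sum_tuple_cons (T : finType) n (P : pred (n.+1.-tuple T)) (F : n.+1.-tuple T -> nat) :
  \sum_(t | P t) F t =
  \sum_c \sum_(t : n.-tuple T | P [tuple of c :: t]) F [tuple of c :: t].
Proof.
rewrite pair_big_dep /=.
rewrite (reindex (fun p : T * n.-tuple T => [tuple of p.1 :: p.2])) //=.
exists (fun t : n.+1.-tuple T => (thead t, [tuple of behead t])) => [[c t]|t] _ /=.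
  by rewrite theadE; congr pair; apply: val_inj.
by rewrite -tuple_eta.
Qed.

Lemma next_state_link k c : (next_state (w k) c == None) = c.2.
Proof. by rewrite /next_state; case: c.2. Qed.

Lemma count_valid n k q : \sum_(t : n.-tuple (config s) | valid k q t) 1 = count_vec n q.
Proof.
elim: n k q => [|n IH] k q.
  rewrite (eq_bigl (fun=> q != None)); last by move=> t; rewrite tuple0.
  by case: q => [x|]; [rewrite sum1_card card_tuple | rewrite big_pred0].
rewrite sum_tuple_cons (bigID (admissible (v k) (w k) q)) /=.
rewrite [X in _ + X]big1 ?addn0; last first.
  by move=> c /negbTE nc; rewrite big1 // => t; rewrite nc.
apply: (sum_admissible (vw k)) => c ac; rewrite -(IH k.+1).
by apply: eq_bigl => t; rewrite /= ac.
Qed.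

(** A product rule: the first copy adds its weight once per completion, hence the term with
    [count_vec] beside [weight_vec]. *)
Lemma weight_valid n k q :
  \sum_(t : n.-tuple (config s) | valid k q t) covered k q t = weight_vec n q.
Proof.
elim: n k q => [|n IH] k q.
  by rewrite big1 // => t; rewrite tuple0.
rewrite sum_tuple_cons (bigID (admissible (v k) (w k) q)) /=.
rewrite [X in _ + X]big1 ?addn0; last first.
  by move=> c /negbTE nc; rewrite big1 // => t; rewrite nc.
apply: (sum_admissible (vw k) (H := fun q' =>
  copy_weight q q' * count_vec n q' + weight_vec n q')) => c ac.
rewrite -(IH k.+1) -(count_valid n k.+1) big_distrr /= -big_split /=.
apply: eq_big => t; rewrite /= ?ac // => _.
by rewrite muln1 card_exposed // /copy_weight next_state_link.
Qed.

Lemma valid_nthP c0 k q t :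
  reflect ((forall j, j < size t ->
              admissible (v (k + j)) (w (k + j))
                (if j is i.+1 then next_state (w (k + i)) (nth c0 t i) else q)
                (nth c0 t j)) /\
           (if size t is i.+1 then next_state (w (k + i)) (nth c0 t i) else q) != None)
          (valid k q t).
Proof.
elim: t k q => [|c t IH] k q /=; first by apply: (iffP idP) => [|[]].
apply: (iffP andP) => [[ac /IH [ht lt]]|[ht lt]].
  split=> [[|j] lj|]; rewrite ?addn0 //.
    rewrite addnS -addSn /=; have := ht j lj.
    by case: j lj => [|j] lj; rewrite ?addn0 // addSn addnS.
  by move: lt; case: (size t) => [|i] /=; rewrite ?addn0 // addSnnS.
split; first by have := ht 0 isT; rewrite /= addn0.
apply/IH; split=> [j lj|].
  have := ht j.+1 lj; rewrite /= addnS -addSn.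
  by case: j lj => [|j] lj; rewrite ?addn0 //= addSn addnS.
by move: lt; case: (size t) => [|i] /=; rewrite ?addn0 // addSnnS.
Qed.

Lemma covered_nth c0 k q t :
  covered k q t = \sum_(j < size t) (s - #|exposed (v (k + j)) (w (k + j))
     (if val j is i.+1 then next_state (w (k + i)) (nth c0 t i) else q) (nth c0 t j)|).
Proof.
elim: t k q => [|c t IH] k q /=; first by rewrite big_ord0.
rewrite big_ord_recl /= addn0 IH; congr (_ + _); apply: eq_bigr => -[j lj] _ /=.
by rewrite /bump /= add1n addnS addSn; case: j lj => [|j] lj; rewrite ?addn0 //= addnS.
Qed.

Lemma admissible_witness k q q' : 0 < transitions s q q' ->
  exists c, admissible (v k) (w k) q c /\ next_state (w k) c = q'.
Proof.
rewrite -(card_transitions (vw k)) card_gt0 => /set0Pn[c].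
by rewrite inE => /andP[ac /eqP nc]; exists c.
Qed.

End Transfer.

(** * Matchings of the chain *)

Section ChainMatchings.
Variables (n s : nat) (v1 v2 : 'I_n -> complete_graph s).
Hypothesis v12 : forall i, v1 i != v2 i.
Local Notation G := (chain_graph v1 v2).
Local Notation link := (@chain_link n s v1 v2).
Local Notation configs := (n.-tuple (config s)).
Implicit Types (t : configs) (M : {set {set G}}) (i j : 'I_n) (x y z : G).

Lemma linkS x y : link x y -> nat_of_ord y.1 = (nat_of_ord x.1).+1.
Proof. by case/and3P => /eqP. Qed.

Lemma link_inj x y x' y' : link x y -> link x' y' -> x.1 = x'.1 -> x = x' /\ y = y'.
Proof.
case: x y x' y' => [i a] [j b] [i' a'] [j' b'].
move=> /and3P[/= /eqP ij /eqP -> /eqP ->] /and3P[/= /eqP ij' /eqP -> /eqP ->] e.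
rewrite /= in ij ij' e; subst i'; have -> : j = j' by apply: val_inj; rewrite /= -ij -ij'.
by [].
Qed.

Lemma link_injr x y x' y' : link x y -> link x' y' -> y.1 = y'.1 -> x = x' /\ y = y'.
Proof.
move=> l l' e; apply: (link_inj l l'); apply: val_inj.
case/and3P: l l' => /eqP h _ _ /and3P[/eqP h' _ _].
by move: h; rewrite e -h' => -[].
Qed.

Lemma link_neq x y : link x y -> x.1 != y.1.
Proof. by move/linkS => h; apply/eqP => e; move: h; rewrite e => /n_Sn. Qed.

Lemma link_asym x y : link x y -> link y x = false.
Proof.
move/linkS => h; apply/negP => /linkS h'.
by move: h h'; move: (nat_of_ord x.1) (nat_of_ord y.1) => ? ?; lia.
Qed.

(** The test [x.2 != y.2] discards singletons that an arbitrary configuration may contain, so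
    [encode t] always consists of edges. *)
Definition config_adj t : rel G := fun x y =>
  [|| [&& x.1 == y.1, x.2 != y.2 & [set x.2; y.2] \in (tnth t x.1).1],
      link x y && (tnth t x.1).2 | link y x && (tnth t y.1).2].

Lemma config_adj_sym t : symmetric (config_adj t).
Proof.
move=> x y; rewrite /config_adj (orbC (link x y && _)) eq_sym (eq_sym x.2).
by rewrite (setUC [set x.2]); case: eqP => [->|].
Qed.

Lemma config_adj_sub t x y : config_adj t x y -> adj x y.
Proof.
by case/or3P => [/and3P[h1 h2 _]|/andP[h _]|/andP[h _]];
  rewrite /= /chain_adj ?h ?h1 ?h2 ?orbT.
Qed.

Definition encode t : {set {set G}} := pairset (config_adj t).

Definition copy_adj M i : rel (complete_graph s) := fun a b =>
  (a != b) && ([set ((i, a) : G); (i, b)] \in M).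

Definition has_link M i :=
  [exists x : G, exists y : G, [&& x.1 == i, link x y & [set x; y] \in M]].

Definition decode M : configs := [tuple (pairset (copy_adj M i), has_link M i) | i < n].

Lemma copy_adj_sym M i : symmetric (copy_adj M i).
Proof. by move=> a b; rewrite /copy_adj eq_sym setUC. Qed.

Lemma copy_sub M i : pairset (copy_adj M i) \subset edges (complete_graph s).
Proof.
apply/subsetP => e /pairsetP[a [b [/andP[ab _] ->]]].
by rewrite (@in_edges (complete_graph s)) adj_complete.
Qed.

Lemma in_encode t x y : ([set x; y] \in encode t) = config_adj t x y.
Proof. exact/in_pairset/config_adj_sym. Qed.

Lemma encode_sub t : encode t \subset edges G.
Proof.
by apply/subsetP => e /pairsetP[x [y [/config_adj_sub xy ->]]]; rewrite in_edges.
Qed.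

Lemma decodeK M : M \subset edges G -> encode (decode M) = M.
Proof.
move=> ME; apply: (edge_set_ext (encode_sub _) ME) => x y xy; rewrite in_encode.
have adj_link x' y' : link x' y' -> has_link M x'.1 = ([set x'; y'] \in M).
  move=> l; apply/existsP/idP => [[x1 /existsP[y1 /and3P[/eqP e l1]]]|h].
    by case: (link_inj l1 l e) => -> ->.
  by exists x'; apply/existsP; exists y'; rewrite eqxx l.
rewrite /config_adj !tnth_mktuple /= in_pairset; last exact: copy_adj_sym.
case/or3P: xy => [/andP[/eqP e ne]|l|l].
- have nl x' y' : x'.1 = y'.1 -> link x' y' = false.
    by move=> e'; apply: contraTF (eqxx x'.1) => /link_neq; rewrite e'.
  rewrite !nl // orbF e eqxx ne /= /copy_adj ne /=.
  by case: (x) (y) e => [? ?] [? ?] /= ->.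
- by rewrite (negbTE (link_neq l)) (link_asym l) l /= orbF (adj_link _ _ l).
- by rewrite eq_sym (negbTE (link_neq l)) (link_asym l) l /= (adj_link _ _ l) setUC.
Qed.

(** These conditions describe the image of [decode]; they exclude what [encode] would forget, namely
    sets that are not edges and a link out of the last copy. *)
Definition wf t := (forall i, (tnth t i).1 \subset edges (complete_graph s)) /\
  (forall i, i.+1 = n -> (tnth t i).2 = false).

Lemma link_exists i (lin : i.+1 < n) :
  link (i, v2 i) (Ordinal lin, v1 (Ordinal lin)).
Proof. by rewrite /chain_link /= !eqxx. Qed.

Lemma wf_decode M : wf (decode M).
Proof.
split=> i; rewrite tnth_mktuple /=.
  exact: copy_sub.
move=> e; apply/existsP => -[x /existsP[y /and3P[/eqP xi /and3P[/eqP h _ _] _]]].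
by have := ltn_ord y.1; rewrite -h xi e ltnn.
Qed.

Lemma encodeK t : wf t -> decode (encode t) = t.
Proof.
move=> [tE tn]; apply: eq_from_tnth => i; rewrite tnth_mktuple.
have := tE i; have := tn i; case e: (tnth t i) => [P b] /= bn PE; congr pair.
  apply: (edge_set_ext (copy_sub _ _) PE) => a a' aa'.
  rewrite in_pairset; last exact: copy_adj_sym.
  rewrite /copy_adj -adj_complete aa' in_encode /config_adj /= eqxx e /=.
  rewrite -adj_complete aa' /= /chain_link /= !(gtn_eqF (ltnSn _)) /=.
  by rewrite !orbF.
apply/existsP/idP => [[x /existsP[y /and3P[/eqP xi l]]]|bt].
  rewrite in_encode /config_adj (negbTE (link_neq l)) l /= xi e /=.
  by rewrite (link_asym l) orbF.
case: (ltnP i.+1 n) => [lin|]; last first.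
  by move=> ni; rewrite bn // in bt; apply/eqP; rewrite eqn_leq ni ltn_ord.
have l := link_exists lin.
exists (i, v2 i); apply/existsP; exists (Ordinal lin, v1 (Ordinal lin)).
rewrite l eqxx /= in_encode /config_adj l.
by rewrite /= e bt orbT.
Qed.

(** The first copy has no incoming link; [Some true] puts no condition on its [v1]. The default of
    [oapp] is never reached, since [k.+1 = i < n]. *)
Definition entry_state t i : state :=
  if val i is k.+1 then
    oapp (fun j => next_state (v2 j) (tnth t j)) (Some true) (insub k)
  else Some true.

Lemma entry_state_link t x y : link x y ->
  entry_state t y.1 = next_state (v2 x.1) (tnth t x.1).
Proof.
case/and3P => /eqP h _ _; rewrite /entry_state [val _]/= -h /=.
case: insubP => [j _ ej|]; last by rewrite ltn_ord.
by rewrite (_ : j = x.1) //; exact: val_inj.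
Qed.

Lemma link_to i : 0 < i -> exists x, link x (i, v1 i).
Proof.
move=> i0; have li : i.-1 < n by have := ltn_ord i; lia.
exists (Ordinal li, v2 (Ordinal li)); rewrite /chain_link /= !eqxx !andbT.
by rewrite prednK.
Qed.

Lemma entry_state_NoneP t x :
  reflect (exists y, link y x /\ (tnth t y.1).2)
          ((entry_state t x.1 == None) && (x.2 == v1 x.1)).
Proof.
apply: (iffP andP) => [[es /eqP xv]|[y [l yl]]].
  have x0 : 0 < x.1 by move: es; rewrite /entry_state /=; case: (nat_of_ord x.1).
  case: (link_to x0) => y; rewrite -xv; case: (x) es {xv x0} => i a /= es l.
  exists y; split=> //; move: es; rewrite (entry_state_link t l) /next_state.
  by case: ifP.
rewrite (entry_state_link t l) /next_state yl eqxx; split=> //.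
by case/and3P: l.
Qed.

Lemma exit_linkP t x : wf t ->
  reflect (exists y, link x y /\ (tnth t x.1).2) ((tnth t x.1).2 && (x.2 == v2 x.1)).
Proof.
move=> [_ tn]; apply: (iffP andP) => [[b /eqP xv]|[y [l b]]]; last first.
  by split=> //; case/and3P: l.
case: (ltnP x.1.+1 n) => [lin|ni].
  have l := link_exists lin; rewrite -xv in l.
  rewrite -surjective_pairing in l.
  by exists (Ordinal lin, v1 (Ordinal lin)).
by rewrite tn // in b; apply/eqP; rewrite eqn_leq ni ltn_ord.
Qed.

Lemma notin_avail a b q e (u : complete_graph s) :
  (u \notin avail a b q e) = ((q == None) && (u == a)) || (e && (u == b)).
Proof. by rewrite inE negbK inE; case: q => [q|]; case: e; rewrite !inE. Qed.

(** A vertex is covered by an inner edge, by the incoming link at [v1] or by the outgoing link at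
    [v2]; the last two are exactly what [avail] removes. *)
Lemma mem_cover_encode t x : wf t ->
  (x \in cover (encode t)) =
  (x.2 \notin exposed (v1 x.1) (v2 x.1) (entry_state t x.1) (tnth t x.1)).
Proof.
move=> wt; have [tE tn] := wt.
rewrite inE negb_and negbK notin_avail.
apply/(mem_coverP _ (encode_sub t))/or3P => [[y]|].
  rewrite in_encode => /or3P[/and3P[/eqP e _ h]|/andP[l h]|/andP[l h]].
  - by constructor 1; apply/(mem_coverP _ (tE _)); exists y.2.
  - by constructor 3; apply/exit_linkP => //; exists y.
  - by constructor 2; apply/entry_state_NoneP; exists y.
case=> [/(mem_coverP _ (tE _))[b xb]|/entry_state_NoneP[y [l h]]|/(exit_linkP _ wt)[y [l h]]].
- exists (x.1, b); rewrite in_encode /config_adj /= eqxx xb andbT.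
  by have := subsetP (tE _) _ xb; rewrite in_edges adj_complete => ->.
- by exists y; rewrite in_encode /config_adj l h !orbT.
- by exists y; rewrite in_encode /config_adj l h !orbT.
Qed.

(** Maximality becomes local: inner edges account for the bound on exposed vertices, links for the
    condition at [v1], and disjointness of links from inner edges for the inclusion in [avail]. *)
Lemma maximal_encodeP t : wf t ->
  reflect (forall i, admissible (v1 i) (v2 i) (entry_state t i) (tnth t i))
          (maximal_matching (encode t)).
Proof.
move=> wt; have [tE tn] := wt; apply: (iffP (maximal_matchingP _)).
  move=> [/matchingP[_ MM] maxM] i.
  have inP a b : [set a; b] \in (tnth t i).1 -> [set (i, a); (i, b)] \in encode t.
    move=> abP; rewrite in_encode /config_adj /= eqxx abP.
    by have := subsetP (tE _) _ abP; rewrite in_edges adj_complete => ->.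
  have mP : matching (tnth t i).1.
    apply/matchingP; split=> // a b c ab ac.
    by have := MM _ _ _ (inP _ _ ab) (inP _ _ ac) => -[].
  apply/and4P; split=> //.
  - apply/subsetP => a /(mem_coverP _ (tE i))[b ab].
    rewrite -[_ \in _]negbK notin_avail; apply/orP => -[].
      move/(entry_state_NoneP t (i, a)) => [y [l h]].
      have := MM _ _ _ (inP _ _ ab) (_ : [set (i, a); y] \in encode t).
      rewrite in_encode /config_adj l h !orbT => /(_ isT) e.
      by have := link_neq l; rewrite -e eqxx.
    move/(exit_linkP (i, a) wt) => [y [l h]].
    have := MM _ _ _ (inP _ _ ab) (_ : [set (i, a); y] \in encode t).
    rewrite in_encode /config_adj l h !orbT => /(_ isT) e.
    by have := link_neq l; rewrite -e eqxx.
  - apply/card_le1_eqP => a b aX bX; apply/eqP; apply: contraT => ab.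
    have := maxM (i, b) (i, a); rewrite !mem_cover_encode //= aX bX /=.
    by rewrite /chain_adj /= eqxx ab => /(_ isT).
  - apply/implyP => /eqP es.
    have i0 : 0 < i by move: es; rewrite /entry_state /=; case: (nat_of_ord i).
    case: (link_to i0) => y l; move: es; rewrite [X in X = _](entry_state_link t l).
    rewrite /next_state; case yb: (tnth t y.1).2 => // -[yc].
    have := maxM y (i, v1 i); rewrite !mem_cover_encode //=.
    rewrite /chain_adj l orbT /= => /(_ isT) /orP[] //.
    have -> : y.2 = v2 y.1 by case/and3P: l => _ /eqP.
    rewrite {1}/exposed inE yc /= yb.
    by rewrite notin_avail /= orbF (eq_sym (v2 _)) (negbTE (v12 _)) andbF.
move=> adm; split; last first.
  move=> x y; rewrite !mem_cover_encode // -negb_and => xy; apply/negP => /andP[xX yX].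
  have nolink x' y' : link x' y' ->
      x'.2 \in exposed (v1 x'.1) (v2 x'.1) (entry_state t x'.1) (tnth t x'.1) ->
      y'.2 \in exposed (v1 y'.1) (v2 y'.1) (entry_state t y'.1) (tnth t y'.1) -> False.
    move=> l x'X y'X; have /and4P[_ _ _] := adm y'.1.
    case/and3P: (l) => _ /eqP ex /eqP ey; rewrite ey in y'X; rewrite y'X implybF.
    rewrite (entry_state_link t l) /next_state.
    move: x'X; rewrite inE ex => /andP[/negbTE ->].
    by rewrite -[_ \in avail _ _ _ _]negbK notin_avail eqxx andbT; case: (tnth t x'.1).2; rewrite ?orbT.
  case/or3P: xy => [/andP[/eqP e ne]|l|l].
  - have /and4P[_ _ /card_le1_eqP le1 _] := adm y.1; rewrite e in xX.
    by rewrite (le1 _ _ xX yX) eqxx in ne.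
  - exact: nolink l xX yX.
  - exact: nolink l yX xX.
apply/matchingP; split=> [|x y z]; first exact: encode_sub.
(* Inner edges end inside [avail] and used links outside it, so the two kinds never meet. An
   incoming and an outgoing link at one vertex would identify [v1] and [v2]. *)
have inF x' y' : [&& x'.1 == y'.1, x'.2 != y'.2 & [set x'.2; y'.2] \in (tnth t x'.1).1] ->
    x'.2 \in avail (v1 x'.1) (v2 x'.1) (entry_state t x'.1) (tnth t x'.1).2.
  move=> /and3P[_ _ h]; have /and4P[_ /subsetP cF _ _] := adm x'.1; apply: cF.
  by apply/(mem_coverP _ (tE _)); exists y'.2.
have outR x' y' : link x' y' && (tnth t x'.1).2 ->
    x'.2 \notin avail (v1 x'.1) (v2 x'.1) (entry_state t x'.1) (tnth t x'.1).2.
  by case/andP => /and3P[_ e _] h; rewrite notin_avail e h orbT.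
have outL x' y' : link y' x' && (tnth t y'.1).2 ->
    x'.2 \notin avail (v1 x'.1) (v2 x'.1) (entry_state t x'.1) (tnth t x'.1).2.
  case/andP => l h; rewrite notin_avail; apply/orP; left.
  by apply/entry_state_NoneP; exists y'.
rewrite !in_encode => /or3P[h|h|h] /or3P[h'|h'|h'].
- case/and3P: h h' => /eqP e _ h /and3P[/eqP e' _ h'].
  have /and4P[/matchingP[_ MM] _ _ _] := adm x.1.
  by case: (y) (z) e e' h h' => ? ? [? ?] /= <- <- h h'; rewrite (MM _ _ _ h h').
- by have := inF _ _ h; rewrite (negbTE (outR _ _ h')).
- by have := inF _ _ h; rewrite (negbTE (outL _ _ h')).
- by have := inF _ _ h'; rewrite (negbTE (outR _ _ h)).
- by case/andP: h h' => l _ /andP[l' _]; case: (link_inj l l' erefl).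
- case/andP: h h' => /and3P[_ /eqP e _] _ /andP[/and3P[_ _ /eqP e'] _].
  by have := v12 x.1; rewrite -e -e' eqxx.
- by have := inF _ _ h'; rewrite (negbTE (outL _ _ h)).
- case/andP: h' h => /and3P[_ /eqP e _] _ /andP[/and3P[_ _ /eqP e'] _].
  by have := v12 x.1; rewrite -e -e' eqxx.
- by case/andP: h h' => l _ /andP[l' _]; case: (link_injr l l' erefl).
Qed.

Lemma nu_chain_le : (nu G).*2 <= n * s.
Proof.
suff : nu G <= (n * s)./2 by lia.
apply/bigmax_leqP => M MM.
have := max_card (mem (cover M)); rewrite card_cover_matching //.
have -> : #|G| = n * s.
  by transitivity #|{: 'I_n * 'I_s}| => //; rewrite card_prod !card_ord.
lia.
Qed.

Variables d1 d2 : complete_graph s.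
Hypothesis d12 : d1 != d2.

(** The transfer recursion needs vertices at all natural indices; the distinct defaults [d1], [d2]
    keep the two extended sequences distinct everywhere. *)
Let w1 k := oapp v1 d1 (insub k).
Let w2 k := oapp v2 d2 (insub k).

Lemma w1E i : w1 i = v1 i. Proof. by rewrite /w1 valK. Qed.
Lemma w2E i : w2 i = v2 i. Proof. by rewrite /w2 valK. Qed.

Lemma w12 k : w1 k != w2 k.
Proof. by rewrite /w1 /w2; case: insubP => //= i _ _; exact: v12. Qed.

Lemma entry_state_nth t i :
  (if val i is k.+1 then next_state (w2 k) (nth (set0, false) t k) else Some true)
  = entry_state t i.
Proof.
rewrite /entry_state; case e: (val i) => [|k] //.
have lk : k < n by have := ltn_ord i; have -> : nat_of_ord i = k.+1 by []; lia.
by rewrite /w2 (insubT (fun k => k < n) lk) /= (tnth_nth (set0, false)).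
Qed.

(** The right-hand side is the range that [reindex_onto] produces when a sum over maximal matchings
    is pulled back along [encode]. *)
Lemma validE t :
  valid w1 w2 0 (Some true) t = maximal_matching (encode t) && (decode (encode t) == t).
Proof.
apply/(valid_nthP _ _ (set0, false))/andP => [[]|[mt /eqP dt]].
  rewrite size_tuple => adm last.
  have adm' i : admissible (v1 i) (v2 i) (entry_state t i) (tnth t i).
    have := adm i (ltn_ord i); rewrite !add0n w1E w2E -tnth_nth.
    by rewrite -entry_state_nth.
  have wt : wf t.
    split=> i; first by case/and4P: (adm' i) => /matching_sub.
    move=> e; move: last; rewrite -{1}e add0n w2E -tnth_nth /next_state.
    by case: (tnth t i).2.
  by rewrite encodeK // eqxx; split=> //; apply/maximal_encodeP.
have wt : wf t by rewrite -dt; exact: wf_decode.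
move/maximal_encodeP: mt => /(_ wt) adm; rewrite size_tuple; split.
  move=> j lj; have := adm (Ordinal lj); rewrite -entry_state_nth /= (tnth_nth (set0, false)) /=.
  by have := w1E (Ordinal lj); have := w2E (Ordinal lj) => /= -> ->.
case e: {1}n => [|k] //; have lk : k < n by rewrite e.
have := w2E (Ordinal lk); rewrite add0n /= => ->.
have [_ /(_ (Ordinal lk) (esym e))] := wt.
by rewrite (tnth_nth (set0, false)) /next_state /= => ->.
Qed.

Lemma covered_encode t : valid w1 w2 0 (Some true) t ->
  covered w1 w2 0 (Some true) t = #|encode t|.*2.
Proof.
rewrite validE => /andP[mt /eqP dt].
have wt : wf t by rewrite -dt; exact: wf_decode.
have [mE _] := maximal_matchingP _ mt.
rewrite -(card_cover_matching mE) (covered_nth _ _ (set0, false)) size_tuple.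
rewrite -sum1_card (eq_bigl (fun x : 'I_n * 'I_s => xpredT x.1 &&
  (x.2 \notin exposed (v1 x.1) (v2 x.1) (entry_state t x.1) (tnth t x.1)))); last first.
  by move=> x; rewrite mem_cover_encode.
rewrite -(pair_big_dep xpredT (fun i a => a \notin exposed (v1 i) (v2 i)
  (entry_state t i) (tnth t i)) (fun _ _ => 1)) /=.
apply: eq_bigr => i _; rewrite add0n w1E w2E -tnth_nth.
rewrite -entry_state_nth /= sum1_card -[X in X - _](card_ord s).
set E := exposed _ _ _ _; rewrite -(cardC (mem E)) addKn.
by apply: eq_card => a; rewrite !inE.
Qed.

Lemma T0_chain : T0 G = count_vec s n (Some true).
Proof.
rewrite -(count_valid w12 n 0) /T0 -sum1dep_card.
rewrite (reindex_onto encode decode) /=; last first.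
  by move=> M /maximal_matchingP[/matching_sub ME _]; exact: decodeK.
by apply: eq_bigl => t; rewrite validE.
Qed.

Lemma T1_chain : (T1 G).*2 = weight_vec s n (Some true).
Proof.
rewrite -(weight_valid w12 n 0) /T1 -mul2n big_distrr /=.
rewrite (reindex_onto encode decode) /=; last first.
  by move=> M /maximal_matchingP[/matching_sub ME _]; exact: decodeK.
apply: eq_big => t; rewrite -validE // => vt.
by rewrite covered_encode // mul2n.
Qed.

Lemma nu_chain_ge m : (exists t : configs,
    valid w1 w2 0 (Some true) t /\ m <= covered w1 w2 0 (Some true) t) -> m <= (nu G).*2.
Proof.
move=> [t [vt mt]]; apply: leq_trans mt _; rewrite covered_encode // leq_double.
move: vt; rewrite validE => /andP[/maximal_matchingP[MM _] _].
exact: leq_bigmax_cond.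
Qed.

End ChainMatchings.

(** * Transfer matrix entries by parity of [s], and nearly perfect matchings of the chain *)

Section Counts.
Variable s : nat.

(** (s-2)!! counts both the perfect matchings of K_(s-1) and the near-perfect ones of K_(s-2), so
    every matrix entry is a multiple of one number. *)
Lemma f_sub2_odd : odd s -> 3 <= s ->
  npairings s.-1 = f (s - 2) /\ (s - 2) * npairings (s - 3) = f (s - 2).
Proof.
move=> os s3; have e : s = (s - 3).+3 by lia.
have o3 : ~~ odd (s - 3) by lia.
have -> : s.-1 = (s - 3).+2 by lia.
have e2 : s - 2 = (s - 3).+1 by lia.
by rewrite fE e2 npairingsSS /near_count /= o3.
Qed.

Lemma transitions_odd (q : state) : odd s -> 3 <= s ->
  [/\ transitions s q None = f (s - 2),
      transitions s q (Some true) =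
        (if q is Some b then s - 2 + b else 1) * f (s - 2)
    & transitions s q (Some false) = (q != None) * f (s - 2)].
Proof.
move=> os s3; have [E1 E2] := f_sub2_odd os s3.
have o1 : odd s.-1 = false by lia.
have o2 : odd s.-2 by lia.
case: q => [[]|]; rewrite /transitions /= ?subn0 /near_count ?os ?o1 ?mul1n ?mul0n.
- by split; rewrite ?E1 //; congr (_ * _); lia.
- by split; rewrite ?E1 //; congr (_ * _); lia.
rewrite subn1 o1 o2; split=> //.
- by rewrite -E2; congr (_ * npairings _); lia.
- exact: npairings_odd.
Qed.

Lemma f_sub2_even : ~~ odd s -> 2 <= s ->
  npairings (s - 2) = f (s - 2) /\ npairings s = s.-1 * f (s - 2).
Proof.
move=> os s2; have o2 : odd (s - 2) = false by lia.
have E : npairings (s - 2) = f (s - 2) by rewrite fE /near_count o2.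
by split=> //; rewrite -E; case: (s) s2 => [|[|k]] // _; rewrite npairingsSS subSS subSS subn0.
Qed.

Lemma transitions_even (q : state) : ~~ odd s -> 2 <= s ->
  [/\ transitions s q None = (if q is Some b then s - 2 + b else 1) * f (s - 2),
      transitions s q (Some true) =
        (if q is Some b then s.-1 else s - 2) * f (s - 2)
    & transitions s q (Some false) = (q == None) * f (s - 2)].
Proof.
move=> os s2; have [E1 E2] := f_sub2_even os s2.
have o1 : odd s.-1 by lia.
have o2 : odd s.-2 = false by lia.
have e2 : s.-2 = s - 2 by lia.
case: q => [[]|]; rewrite /transitions /= ?subn0 /near_count ?(negbTE os) ?o1 ?mul1n ?mul0n.
- by rewrite E2 (npairings_odd o1) e2 E1; split=> //; congr (_ * _); lia.
- by rewrite E2 (npairings_odd o1) e2 E1; split=> //; congr (_ * _); lia.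
by rewrite subn1 o1 o2 e2 E1.
Qed.

Lemma f_gt0 m : 0 < f m.
Proof.
rewrite fE /near_count; case: ifP => om; last by rewrite npairings_gt0 ?om.
by rewrite muln_gt0 npairings_gt0; move: om; case: m => //= m /negbTE ->.
Qed.

Variables v w : nat -> complete_graph s.
Hypothesis vw : forall k, v k != w k.
Hypothesis s2 : 2 <= s.

(** For even [s] each copy is perfectly matched without links. For odd [s] the copies are joined in
    pairs by a used link, which leaves an even number of vertices in each; a vertex stays exposed
    only if [n] is odd. *)
Lemma large_valid n k : exists t : n.-tuple (config s),
  valid v w k (Some true) t /\ (n * s).-1 <= covered v w k (Some true) t.
Proof.
have step q q' k' n' (m : nat) : 0 < transitions s q q' ->
    (exists t : n'.-tuple (config s), valid v w k'.+1 q' t /\ m <= covered v w k'.+1 q' t) ->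
    exists t : n'.+1.-tuple (config s), valid v w k' q t /\
      copy_weight s q q' + m <= covered v w k' q t.
  move=> /(admissible_witness vw k')[c [ac nc]] [t [vt mt]].
  exists [tuple of c :: t]; rewrite /= ac nc vt; split=> //.
  by rewrite (card_exposed (vw k') ac) /copy_weight -(next_state_link w k') nc leq_add2l.
have F0 := f_gt0 (s - 2).
have nil k' : exists t : 0.-tuple (config s), valid v w k' (Some true) t /\
    0 <= covered v w k' (Some true) t by exists [tuple].
case os: (odd s).
  have s3 : 3 <= s by move: s2 os; rewrite leq_eqVlt => /orP[/eqP<-|].
  have [M1 M2 _] := transitions_odd (Some true) os s3.
  have [_ U2 _] := transitions_odd None os s3.
  elim/ltn_ind: n k => -[|[|n]] IH k; first exact: nil.
    case: (step (Some true) (Some true) k 0 0 _ (nil _)).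
      by rewrite M2 muln_gt0 F0; lia.
    by rewrite /copy_weight !subn0 os => t [vt mt]; exists t; split=> //; lia.
  have /(step None (Some true) k.+1) := IH n (leqW (leqnn _)) k.+2.
  case; first by rewrite U2 mul1n.
  move=> t ht; case: (step (Some true) None k _ _ _ (ex_intro _ t ht)).
    by rewrite M1.
  rewrite /copy_weight /= !subn0 subn1; have -> : odd s.-1 = false by lia.
  by move=> t' [vt' mt']; exists t'; split=> //; apply: leq_trans mt'; nia.
have [_ M2 _] := transitions_even (Some true) (negbT os) s2.
elim: n k => [|n IH] k; first exact: nil.
case: (step (Some true) (Some true) k _ _ _ (IH k.+1)).
  by rewrite M2 muln_gt0 F0; lia.
rewrite /copy_weight !subn0 os => t [vt mt]; exists t; split=> //.
apply: leq_trans mt; nia.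
Qed.

End Counts.

Lemma nu_chain_bounds n s (v1 v2 : 'I_n -> complete_graph s) :
  (forall i, v1 i != v2 i) -> 2 <= s ->
  (n * s).-1 <= (nu (chain_graph v1 v2)).*2 <= n * s.
Proof.
move=> v12 s2; rewrite nu_chain_le andbT.
have d12 : Ordinal s2 != Ordinal (ltnW s2) by [].
by apply: (@nu_chain_ge _ _ _ _ v12 _ _ d12); apply: large_valid => //; exact: w12.
Qed.

(* Required only here: all_classical shadows the finite-set lemmas used above. *)
From mathcomp Require Import all_classical all_reals all_analysis.
Import numFieldNormedType.Exports.

(** * Linear recurrences *)

Local Open Scope classical_set_scope.
Local Open Scope ring_scope.

Section LinearRecurrences.
Variable R : realType.
Implicit Types (u v t : R^nat) (b c : R).

Lemma perturbed_geometric_cvg0 (th : R) u v : 0 <= th < 1 ->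
  (forall n, 0 <= u n) -> (forall n, u n.+1 <= th * u n + v n) ->
  v @ \oo --> (0 : R) -> u @ \oo --> (0 : R).
Proof.
move=> /andP[th0 th1] u0 uS v0; apply/cvgr0Pnorm_lt => e e0.
(* With this bound on [v], the affine recursion has fixed point [e / 2]. *)
have e'0 : 0 < e * (1 - th) / 2 by apply: divr_gt0 => //; nra.
have /cvgr0Pnorm_lt /(_ _ e'0) [N _ vN] := v0.
have bound k : u (N + k)%N <= th ^+ k * u N + e / 2.
  elim: k => [|k IH]; first by rewrite addn0 expr0 mul1r; lra.
  rewrite addnS exprS; apply: le_trans (uS _) _.
  have := vN (N + k)%N (leq_addr _ _) => /= /ltr_normlW.
  nra.
have pw : (fun k => th ^+ k * u N) @ \oo --> (0 : R).
  rewrite -(mul0r (u N)); apply: cvgMl; apply: cvg_expr.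
  by rewrite ger0_norm.
have e2 : 0 < e / 2 by lra.
have /cvgr0Pnorm_lt /(_ _ e2) [K _ pK] := pw.
exists (N + K)%N => // n /= Kn; rewrite ger0_norm //.
have -> : n = (N + (n - N))%N by rewrite subnKC //; apply: leq_trans Kn; exact: leq_addr.
apply: le_lt_trans (bound _) _.
have := pK (n - N)%N => /=; rewrite leq_subRL; last by apply: leq_trans Kn; exact: leq_addr.
move=> /(_ Kn) /ltr_normlW; lra.
Qed.

(* With [`|c| < al < 1 - `|b|], the quantity [`|u n.+1| + al * `|u n|] contracts. *)
Lemma second_order_cvg0 b c u v : `|b| + `|c| < 1 ->
  (forall n, u n.+2 = b * u n.+1 - c * u n + v n) ->
  v @ \oo --> (0 : R) -> u @ \oo --> (0 : R).
Proof.
move=> bc uS v0; have b0 := normr_ge0 b; have c0 := normr_ge0 c.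
pose al := (`|c| + 1 - `|b|) / 2.
have al0 : 0 < al by rewrite /al; lra.
(* The two entries are the contraction rates of the parts in [|u n.+1|] and in [al * |u n|]. *)
pose th := Num.max (`|b| + al) (`|c| / al).
have thb : `|b| + al <= th by rewrite le_max lexx.
have thc : `|c| <= th * al.
  by rewrite -ler_pdivrMr // le_max lexx orbT.
have th1 : th < 1.
  by rewrite gt_max ltr_pdivrMr // mul1r; apply/andP; split; rewrite /al; lra.
pose N n := `|u n.+1| + al * `|u n|.
suff N0 : N @ \oo --> (0 : R).
  rewrite -cvg_shiftS; apply: norm_cvg0; apply: (squeeze_cvgr _ (cvg_cst 0) N0).
  by near=> n; rewrite normr_ge0 /N lerDl mulr_ge0 // ltW.
apply: (@perturbed_geometric_cvg0 th N (fun n => `|v n|)).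
- by rewrite th1 andbT; apply: le_trans thb; lra.
- by move=> n; rewrite /N addr_ge0 // mulr_ge0 // ltW.
- move=> n; rewrite /N uS.
  have h : `|b * u n.+1 - c * u n + v n| <= `|b| * `|u n.+1| + `|c| * `|u n| + `|v n|.
    rewrite -!normrM; apply: le_trans (ler_normD _ _) _; rewrite lerD2r.
    exact: ler_normB.
  have := normr_ge0 (u n.+1); have := normr_ge0 (u n); nra.
- by rewrite -(@normr0 _ R); apply: cvg_norm.
Unshelve. all: by end_near. Qed.

Lemma second_order_cvg b c u v (l : R) : `|b| + `|c| < 1 ->
  (forall n, u n.+2 = b * u n.+1 - c * u n + v n) ->
  v @ \oo --> l -> u @ \oo --> l / (1 - b + c).
Proof.
move=> bc uS vl.
have d0 : 1 - b + c != 0.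
  have := ler_norm b; have := ler_norm (- c); rewrite normrN => ? ?.
  by rewrite gt_eqF //; lra.
set m := l / _.
have ml : m * (1 - b + c) = l by rewrite /m divfK.
have -> : u = (fun n => (u n - m) + m) by apply/funext => n; rewrite subrK.
rewrite -[X in _ --> X]add0r; apply: cvgD; last exact: cvg_cst.
apply: (@second_order_cvg0 b c _ (fun n => v n - l)) => //.
  by move=> n; rewrite uS -ml; ring.
by rewrite -(subrr l); apply: cvgB => //; exact: cvg_cst.
Qed.

(** The characteristic polynomial is (X - 1)(X^2 - b X + c), so [u n.+2 - b * u n.+1 + c * u n] is
    constant in [n] and the order drops by one. *)
Lemma third_order_cvg b c u : `|b| + `|c| < 1 ->
  (forall n, u n.+3 = (1 + b) * u n.+2 - (b + c) * u n.+1 + c * u n) ->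
  u @ \oo --> (u 2 - b * u 1 + c * u 0) / (1 - b + c).
Proof.
move=> bc uS; set w := u 2 - _ + _.
apply: (second_order_cvg bc (v := fun=> w)); last exact: cvg_cst.
have wE n : w = u n.+2 - b * u n.+1 + c * u n.
  by elim: n => [//|n ->]; rewrite uS; ring.
by move=> n; rewrite (wE n); ring.
Qed.

(** Taking differences of [t] removes the factor X - 1 and leaves a second-order recurrence with
    convergent source. The last hypothesis makes the limit [U] of [u] positive, so that it cancels
    from the quotient. *)
Lemma third_order_ratio_cvg b c (g1 g2 g3 : R) u t : `|b| + `|c| < 1 ->
  (forall n, u n.+3 = (1 + b) * u n.+2 - (b + c) * u n.+1 + c * u n) ->
  (forall n, t n.+3 = (1 + b) * t n.+2 - (b + c) * t n.+1 + c * t n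
                      + (g1 * u n.+2 - g2 * u n.+1 + g3 * u n)) ->
  t 0 = 0 -> 0 < u 2 - b * u 1 + c * u 0 ->
  t n.+1 / (n.+1%:R * u n.+1) @[n --> \oo] --> (g1 - g2 + g3) / (1 - b + c).
Proof.
move=> bc uS tS t0 w0; set w := u 2 - _ + _ in w0.
have q0 : 0 < 1 - b + c.
  by have := ler_norm b; have := ler_norm (- c); rewrite normrN; lra.
pose U := w / (1 - b + c).
have uU : u @ \oo --> U by exact: third_order_cvg.
have U0 : 0 < U by exact: divr_gt0.
pose d n := t n.+1 - t n.
have dl : d @ \oo --> ((g1 - g2 + g3) * U) / (1 - b + c).
  apply: (second_order_cvg bc (v := fun n => g1 * u n.+2 - g2 * u n.+1 + g3 * u n)).
    by move=> n; rewrite /d tS; ring.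
  have u1 : u n.+1 @[n --> \oo] --> U by rewrite cvg_shiftS.
  have u2 : u n.+2 @[n --> \oo] --> U.
    by rewrite (cvg_shiftS (fun n => u n.+1)).
  rewrite mulrDl mulrBl.
  by apply: cvgD; [apply: cvgB|]; apply: cvgMr.
have tE n : t n.+1 / (n.+1%:R * u n.+1) = arithmetic_mean d n / u n.+1.
  rewrite /arithmetic_mean /series /= /d telescope_sumr // t0 subr0.
  by rewrite invfM mulrA [_^-1 * t _]mulrC.
under eq_fun do rewrite tE.
have -> : (g1 - g2 + g3) / (1 - b + c) = ((g1 - g2 + g3) * U) / (1 - b + c) / U.
  by field; rewrite !gt_eqF.
apply: cvgM; first exact: cesaro.
by apply: cvgV; rewrite ?gt_eqF // cvg_shiftS.
Qed.

End LinearRecurrences.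

(** * The limit *)

(** If [r <= x], then x (x - b) >= r (r - b) > c, against the first inequality. *)
Lemma lt_of_quadratic_le (R : realType) (x r b c : R) : 0 < r -> 0 <= b -> 0 <= c ->
  x * x <= b * x + c -> b * r + c < r ^+ 2 -> x < r.
Proof.
move=> r0 b0 c0 h1; rewrite expr2 => h2; have br : b < r by nra.
by case: (ltP x r) => // rx; nra.
Qed.

Section DominantRoot.
Variables (R : realType) (e1 e2 e3 r : R).
Hypothesis r0 : 0 < r.
Hypothesis rE : r ^+ 3 = e1 * r ^+ 2 - e2 * r + e3.
Hypothesis dom : `|e1 - r| * r + `|e3 / r| < r ^+ 2.

(** Comparison of coefficients in X^3 - e1 X^2 + e2 X - e3 = (X - r)(X^2 - (e1 - r) X + e3 / r). *)
Let e2E : e2 = r * (e1 - r) + e3 / r.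
Proof.
apply: (mulIf (lt0r_neq0 r0)); rewrite mulrDl divfK ?gt_eqF //.
have -> : e2 * r = e1 * r ^+ 2 + e3 - r ^+ 3 by rewrite rE; ring.
by ring.
Qed.

(** A root z other than r satisfies z^2 = b z - c, hence |z|^2 <= |b| |z| + |c|, and [dom] then
    gives |z| < r. *)
Lemma cubic_max_modulus_root :
  max_modulus_root ('X^3 - e1 *: 'X^2 + e2 *: 'X - e3%:P) (real_complex R r).
Proof.
split.
  apply/rootP; rewrite horner_map; apply/eqP; rewrite fmorph_eq0.
  have -> : ('X^3 - e1 *: 'X^2 + e2 *: 'X - e3%:P).[r] =
      r ^+ 3 - (e1 * r ^+ 2 - e2 * r + e3) by rewrite !hornerE; ring.
  by rewrite rE subrr.
move=> z /rootP.
rewrite !(rmorphB, rmorphD) /= !map_polyZ !map_polyXn map_polyX map_polyC /=.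
rewrite !(hornerD, hornerN, hornerZ, hornerXn, hornerX, hornerC) => pz zr.
pose b := e1 - r; pose c := e3 / r.
have e1E : e1 = b + r by rewrite /b subrK.
have e3E : e3 = c * r by rewrite /c divfK // gt_eqF.
have e2E' : e2 = r * b + c := e2E.
have dom' : `|b| * r + `|c| < r ^+ 2 := dom.
clearbody b c.
have zz : z * z = (real_complex R b) * z - real_complex R c.
  move: pz; rewrite e1E e2E' e3E !(rmorphD, rmorphM) /= => pz.
  have /eqP : (z - real_complex R r) * (z * z - (real_complex R b * z - real_complex R c)) = 0.
    by rewrite -pz; ring.
  by rewrite mulf_eq0 !subr_eq0 (negbTE zr) => /eqP.
have nR x : Normc.normc (real_complex R x) = `|x|.
  by rewrite /Normc.normc /= expr0n /= addr0 sqrtr_sqr.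
(* The modulus on [R[i]] is itself complex-valued; exposing its real part moves the comparison to
   [R]. *)
rewrite -[`|z|]/((Normc.normc z)%:C)%C -[`|_ r|]/((Normc.normc (real_complex R r))%:C)%C.
rewrite ltcR nR (gtr0_norm r0).
have : Normc.normc z * Normc.normc z <= `|b| * Normc.normc z + `|c|.
  rewrite -Normc.normcM zz -(nR b) -Normc.normcM -(nR c) -(normcN (real_complex R c)).
  exact: le_normcD.
by move=> h; apply: (lt_of_quadratic_le r0 _ _ h dom'); exact: normr_ge0.
Qed.

(** Division by r^n moves the root r to 1. The denominator of the limit is r p'(r) for the cubic p,
    which equals r^3 (1 - b + c) in the rescaled coefficients. *)
Lemma cubic_ratio_cvg (g1 g2 g3 : R) (u t : R^nat) :
  (forall n, u n.+3 = e1 * u n.+2 - e2 * u n.+1 + e3 * u n) ->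
  (forall n, t n.+3 = e1 * t n.+2 - e2 * t n.+1 + e3 * t n
                      + (g1 * u n.+2 - g2 * u n.+1 + g3 * u n)) ->
  t 0 = 0 -> 0 < u 2 - (e1 - r) * u 1 + e3 / r * u 0 ->
  t n.+1 / (n.+1%:R * u n.+1) @[n --> \oo] -->
    (g1 * r ^+ 2 - g2 * r + g3) / (e1 * r ^+ 2 - 2 * e2 * r + 3 * e3).
Proof.
move=> uS tS t0 w0; have rn0 : r != 0 by rewrite gt_eqF.
pose b := (e1 - r) / r; pose c := e3 / r / r ^+ 2.
have bc : `|b| + `|c| < 1.
  rewrite /b /c !normrM !normfV (gtr0_norm r0) (gtr0_norm (exprn_gt0 2 r0)).
  rewrite -(ltr_pM2r (exprn_gt0 2 r0)) mul1r mulrDl.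
  have -> : `|e1 - r| / r * r ^+ 2 = `|e1 - r| * r by field.
  have -> : `|e3| / r / r ^+ 2 * r ^+ 2 = `|e3| / r by field.
  by move: dom; rewrite normrM normfV (gtr0_norm r0).
have := @third_order_ratio_cvg _ b c (g1 / r) (g2 / r ^+ 2) (g3 / r ^+ 3)
  (fun n => u n / r ^+ n) (fun n => t n / r ^+ n) bc.
have -> : (g1 / r - g2 / r ^+ 2 + g3 / r ^+ 3) / (1 - b + c) =
    (g1 * r ^+ 2 - g2 * r + g3) / (e1 * r ^+ 2 - 2 * e2 * r + 3 * e3).
  have q0 : 0 < 1 - b + c.
    by have := ler_norm b; have := ler_norm (- c); rewrite normrN; lra.
  have -> : e1 * r ^+ 2 - 2 * e2 * r + 3 * e3 = r ^+ 3 * (1 - b + c).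
    by rewrite e2E /b /c; field.
  by field; rewrite rn0 gt_eqF.
under eq_fun => n.
  have -> : t n.+1 / r ^+ n.+1 / (n.+1%:R * (u n.+1 / r ^+ n.+1)) =
            t n.+1 / (n.+1%:R * u n.+1).
    have rS : r ^+ n.+1 != 0 by rewrite expf_neq0.
    by rewrite [_ * (_ / _)]mulrA [(_ * _ / _)^-1]invfM invrK mulrACA mulVf ?mulr1.
  over.
apply.
- move=> n; rewrite uS !exprS /b /c e2E; field; rewrite rn0 expf_neq0 //.
- move=> n; rewrite tS !exprS /b /c e2E; field; rewrite rn0 expf_neq0 //.
- by rewrite t0 mul0r.
have -> : u 2 / r ^+ 2 - b * (u 1 / r ^+ 1) + c * (u 0 / r ^+ 0) =
    (u 2 - (e1 - r) * u 1 + e3 / r * u 0) / r ^+ 2.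
  by rewrite /b /c; field.
by rewrite divr_gt0 // exprn_gt0.
Qed.

End DominantRoot.

(** * The limit for the chain, for each parity of [s] *)

Section ChainLimit.
Variables (R : realType) (s : nat).
Hypothesis s2 : (2 <= s)%N.
Variables v1 v2 : forall n : nat, 'I_n -> 'I_s.
Hypothesis v12 : forall n (i : 'I_n), v1 i != v2 i.
Local Notation S := (s%:R : R).
Local Notation F := ((f (s - 2))%:R : R).
Local Notation cnt n q := ((count_vec s n q)%:R : R).
Local Notation wgt n q := ((weight_vec s n q)%:R : R).

(** The weights give 2 T1 and the bounds concern 2 nu, so the factors cancel; 2 nu / n tends to s by
    squeezing. *)
Lemma calI_chain_cvg (l : R) :
  wgt n.+1 (Some true) / (n.+1%:R * cnt n.+1 (Some true)) @[n --> \oo] --> l ->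
  calI (chain_graph (@v1 n) (@v2 n)) R @[n --> \oo] --> l / S.
Proof.
move=> hl; rewrite -cvg_shiftS.
pose N n := ((nu (chain_graph (@v1 n.+1) (@v2 n.+1))).*2)%:R : R.
have S0 : S != 0 by rewrite pnatr_eq0; lia.
have bnd n := nu_chain_bounds (@v12 n.+1) s2.
have NS : N n / n.+1%:R @[n --> \oo] --> S.
  have lo : S - n.+1%:R^-1 @[n --> \oo] --> S.
    rewrite -[X in _ --> X]subr0; apply: cvgB; first exact: cvg_cst.
    exact: cvg_harmonic.
  apply: (squeeze_cvgr _ lo (cvg_cst S)); near=> n.
  have n0 : 0 < n.+1%:R :> R by [].
  have /andP[h1 h2] := bnd n; rewrite ler_pdivlMr // ler_pdivrMr //.
  rewrite mulrBl mulVf ?gt_eqF // lerBlDr /N -!natrM natr1 !ler_nat mulnC.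
  by rewrite h2 andbT; lia.
have E n : calI (chain_graph (@v1 n.+1) (@v2 n.+1)) R =
    wgt n.+1 (Some true) / (n.+1%:R * cnt n.+1 (Some true)) / (N n / n.+1%:R).
  have d12 : Ordinal s2 != Ordinal (ltnW s2) by [].
  have /andP[h1 h2] := bnd n.
  have nu0 : nu (chain_graph (@v1 n.+1) (@v2 n.+1)) != 0%N by apply/eqP => e; move: h1; rewrite e; nia.
  rewrite /calI (negbTE nu0) -(T1_chain (@v12 n.+1) d12) -(T0_chain (@v12 n.+1) d12).
  rewrite /N -!mul2n !natrM; set T := (T0 _)%:R; set U := (T1 _)%:R.
  have n0 : n.+1%:R != 0 :> R by [].
  have nu0' : (nu (chain_graph (@v1 n.+1) (@v2 n.+1)))%:R != 0 :> R by rewrite pnatr_eq0.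
  (* For [T = 0] both sides vanish, as the inverse of 0 is 0. *)
  have [->|T0'] := eqVneq T 0; first by rewrite !mulr0 invr0 !(mulr0, mul0r).
  by move: n.+1%:R n0 => m n0; field; rewrite T0' nu0' n0.
under eq_fun do rewrite E.
by apply: cvgM => //; apply: cvgV.
Unshelve. all: by end_near. Qed.

Lemma calI_chain_cubic_cvg (e1 e2 e3 r g1 g2 g3 : R) :
  0 < r -> r ^+ 3 = e1 * r ^+ 2 - e2 * r + e3 ->
  `|e1 - r| * r + `|e3 / r| < r ^+ 2 ->
  (forall n, cnt n.+3 (Some true) = e1 * cnt n.+2 (Some true)
     - e2 * cnt n.+1 (Some true) + e3 * cnt n (Some true)) ->
  (forall n, wgt n.+3 (Some true) = e1 * wgt n.+2 (Some true)
     - e2 * wgt n.+1 (Some true) + e3 * wgt n (Some true)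
     + (g1 * cnt n.+2 (Some true) - g2 * cnt n.+1 (Some true)
        + g3 * cnt n (Some true))) ->
  0 < cnt 2 (Some true) - (e1 - r) * cnt 1 (Some true) + e3 / r * cnt 0 (Some true) ->
  forall A B : R, A = (g1 * r ^+ 2 - g2 * r + g3) / 2 ->
  B = e1 * r ^+ 2 - 2 * e2 * r + 3 * e3 ->
  calI (chain_graph (@v1 n) (@v2 n)) R @[n --> \oo] --> A / (S / 2 * B).
Proof.
move=> r0 rE dom cS wS c0 A B -> ->.
set D := e1 * _ - _ + _; set N := g1 * _ - _ + _.
have -> : N / 2 / (S / 2 * D) = N / D / S.
  by rewrite !invfM invrK; move: (D^-1) (S^-1) => d a; field.
apply: calI_chain_cvg.
exact: (cubic_ratio_cvg r0 rE dom (u := fun n => cnt n (Some true))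
  (t := fun n => wgt n (Some true))).
Qed.

Lemma odd_step : odd s -> (3 <= s)%N -> forall n,
  [/\ cnt n.+1 None = F * (cnt n None + cnt n (Some true)),
      cnt n.+1 (Some true) =
        F * (cnt n None + (S - 1) * cnt n (Some true) + cnt n (Some false)),
      cnt n.+1 (Some false) =
        F * (cnt n None + (S - 2) * cnt n (Some true) + cnt n (Some false)),
      wgt n.+1 None = F * ((S - 1) * cnt n None + wgt n None
        + S * cnt n (Some true) + wgt n (Some true))
    & (wgt n.+1 (Some true) = F * (S * cnt n None + wgt n None
        + (S - 1) * ((S - 1) * cnt n (Some true) + wgt n (Some true))
        + (S - 1) * cnt n (Some false) + wgt n (Some false)) /\
      wgt n.+1 (Some false) = F * (S * cnt n None + wgt n None
        + (S - 2) * ((S - 1) * cnt n (Some true) + wgt n (Some true))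
        + (S - 1) * cnt n (Some false) + wgt n (Some false)))].
Proof.
move=> os s3 n.
have [U1 U2 U3] := transitions_odd None os s3.
have [M1 M2 M3] := transitions_odd (Some true) os s3.
have [N1 N2 N3] := transitions_odd (Some false) os s3.
have p1 : odd (s - 1) = false by lia.
have p2 : odd (s - 1 - 1) by lia.
have s1 : (0 < s)%N by lia.
rewrite !count_vecS !weight_vecS U1 U2 U3 M1 M2 M3 N1 N2 N3 /copy_weight /=.
rewrite !subn0 p1 p2 os !(natrD, natrM) /= subn0 !natrB //.
by split; try split; ring.
Qed.

Lemma even_step : ~~ odd s -> forall n,
  [/\ cnt n.+1 None = F * (cnt n None + (S - 2) * cnt n (Some true) + cnt n (Some false)),
      cnt n.+1 (Some true) = F * ((S - 1) * cnt n None + (S - 1) * cnt n (Some true)),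
      cnt n.+1 (Some false) = F * ((S - 2) * cnt n None + (S - 1) * cnt n (Some true)),
      wgt n.+1 None = F * (S * cnt n None + wgt n None
        + (S - 2) * ((S - 1) * cnt n (Some true) + wgt n (Some true))
        + (S - 1) * cnt n (Some false) + wgt n (Some false))
    & (wgt n.+1 (Some true) = F * (S - 1) * ((S - 1) * cnt n None + wgt n None
        + S * cnt n (Some true) + wgt n (Some true)) /\
      wgt n.+1 (Some false) = F * ((S - 2) * ((S - 1) * cnt n None + wgt n None)
        + (S - 1) * (S * cnt n (Some true) + wgt n (Some true))))].
Proof.
move=> os n.
have [U1 U2 U3] := transitions_even None os s2.
have [M1 M2 M3] := transitions_even (Some true) os s2.
have [N1 N2 N3] := transitions_even (Some false) os s2.
have p1 : odd (s - 1) by lia.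
have p2 : odd (s - 1 - 1) = false by lia.
have s1 : (0 < s)%N by lia.
rewrite !count_vecS !weight_vecS U1 U2 U3 M1 M2 M3 N1 N2 N3 /copy_weight /=.
rewrite !subn0 p1 p2 (negbTE os) -subn1 !(natrD, natrM) /= subn0 !natrB //.
by split; try split; ring.
Qed.

Lemma F_gt0 : 0 < F.
Proof. by rewrite ltr0n f_gt0. Qed.

(** The cubic after the substitution r = F x takes the value -1 at [S] and S^2 + S - 1 at
    [S + 1]. *)
Lemma odd_root : 3 <= S ->
  exists2 x : R, S < x <= S + 1 & x ^+ 3 = (S + 1) * x ^+ 2 - S * x + 1.
Proof.
move=> S3; pose p : {poly R} := 'X^3 - (S + 1) *: 'X^2 + S *: 'X - 1%:P.
have pE y : p.[y] = y ^+ 3 - (S + 1) * y ^+ 2 + S * y - 1.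
  by rewrite !(hornerD, hornerN, hornerZ, hornerXn, hornerX, hornerC).
have pS : p.[S] = - 1 by rewrite pE; ring.
have [||x /andP[x1 x2] /rootP px] := @poly_ivt _ p S (S + 1).
- by lra.
- by rewrite pS pE; apply/andP; split; nra.
exists x; last by apply/eqP; rewrite -subr_eq0 -px pE; apply/eqP; ring.
rewrite lt_neqAle x1 x2 !andbT; apply/eqP => e; move: px; rewrite -e pS => /eqP.
by rewrite oppr_eq0 oner_eq0.
Qed.

Lemma odd_chain : odd s -> (3 <= s)%N -> exists r : R,
  max_modulus_root
    ('X^3 - ((S + 1) * F) *: 'X^2 + (S * F ^+ 2) *: 'X - (F ^+ 3)%:P) (real_complex R r)
  /\ calI (chain_graph (@v1 n) (@v2 n)) R @[n --> \oo] -->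
     (r ^+ 2 * ((S ^+ 2 - 1) / 2) * F - r * (S ^+ 2 - S - 1) * F ^+ 2
        + (3 * (S - 1)) / 2 * F ^+ 3)
     / (S / 2 * (r ^+ 2 * (S + 1) * F - 2 * r * S * F ^+ 2 + 3 * F ^+ 3)).
Proof.
move=> os s3; have S3 : 3 <= S by rewrite (ler_nat _ 3).
have F0 := F_gt0; have [x /andP[Sx x1] xE] := odd_root S3.
have x0 : 0 < x by lra.
have xV : x^-1 < 1 by rewrite invf_lt1 //; lra.
have xV0 : 0 < x^-1 by rewrite invr_gt0.
pose r := F * x; have r0 : 0 < r by exact: mulr_gt0.
have rE : r ^+ 3 = (S + 1) * F * r ^+ 2 - S * F ^+ 2 * r + F ^+ 3.
  by rewrite /r exprMn xE; ring.
have e1E : (S + 1) * F - r = F * (S + 1 - x) by rewrite /r; ring.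
have e3E : F ^+ 3 / r = F ^+ 2 * x^-1 by rewrite /r; field; rewrite !gt_eqF.
have dom : `|(S + 1) * F - r| * r + `|F ^+ 3 / r| < r ^+ 2.
  rewrite e1E e3E !ger0_norm; try by rewrite mulr_ge0 // ?exprn_ge0 //; lra.
  have -> : F * (S + 1 - x) * r + F ^+ 2 * x^-1 = F ^+ 2 * ((S + 1 - x) * x + x^-1).
    by rewrite /r; ring.
  by rewrite /r exprMn ltr_pM2l ?exprn_gt0 //; nra.
exists r; split; first exact: cubic_max_modulus_root.
have st n := odd_step os s3 n.
have c1 n : _ := let: And5 h _ _ _ _ := st n in h.
have c2 n : _ := let: And5 _ h _ _ _ := st n in h.
have c3 n : _ := let: And5 _ _ h _ _ := st n in h.
have w1 n : _ := let: And5 _ _ _ h _ := st n in h.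
have w2 n : _ := let: And5 _ _ _ _ (conj h _) := st n in h.
have w3 n : _ := let: And5 _ _ _ _ (conj _ h) := st n in h.
(* Derivatives at y = 1 of the weighted coefficients (s+1) F y^(s-1), F^2 ((s+1) y^(2s-2) - y^(2s))
   and F^3 y^(3s-3). *)
apply: (calI_chain_cubic_cvg (g1 := (S ^+ 2 - 1) * F)
  (g2 := 2 * (S ^+ 2 - S - 1) * F ^+ 2) (g3 := 3 * (S - 1) * F ^+ 3) r0 rE dom).
- by move=> n; rewrite !(c1, c2, c3); ring.
- by move=> n; rewrite !(c1, c2, c3, w1, w2, w3); ring.
(* The counts for n = 2, 1, 0 are F^2 S^2, F S and 1; positivity uses S + 1 - x < 1. *)
- rewrite e1E e3E !(c1, c2, c3) /=.
  rewrite [ltRHS](_ : _ = F ^+ 2 * (S ^+ 2 - (S + 1 - x) * S + x^-1)); last by ring.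
  by apply: mulr_gt0; [exact: exprn_gt0 | nra].
- by field.
- by ring.
Qed.

(** The cases differ in the sign of [S - x]: for s = 2 the linear coefficient S^2 - 3S + 1 is
    negative and x lies below S, while for s >= 4 it lies above. *)
Lemma even_root : ~~ odd s -> exists2 x : R,
    x ^+ 3 = S * x ^+ 2 + (S ^+ 2 - 3 * S + 1) * x + (S - 1)
    & 1 < x /\ `|S - x| * x + (S - 1) * x^-1 < x ^+ 2.
Proof.
move=> os.
pose p : {poly R} := 'X^3 - S *: 'X^2 - (S ^+ 2 - 3 * S + 1) *: 'X - (S - 1)%:P.
have pE y : p.[y] = y ^+ 3 - S * y ^+ 2 - (S ^+ 2 - 3 * S + 1) * y - (S - 1).
  by rewrite !(hornerD, hornerN, hornerZ, hornerXn, hornerX, hornerC).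
have rootE y : root p y -> y ^+ 3 = S * y ^+ 2 + (S ^+ 2 - 3 * S + 1) * y + (S - 1).
  by move/rootP => py; apply/eqP; rewrite -subr_eq0 -py pE; apply/eqP; ring.
case: (ltnP s 3) => s3.
  have S2 : S = 2 by have -> : s = 2%N by lia.
  (* The lower end 3/2 keeps x away from 1, where the dominance inequality fails. *)
  have [||x /andP[x1 x2] px] := @poly_ivt _ p (3 / 2) 2.
  - by lra.
  - by rewrite !pE S2; apply/andP; split; lra.
  exists x; first exact: rootE.
  rewrite S2; have x0 : 0 < x by lra.
  have xV : x^-1 <= 2 / 3.
    by rewrite -[X in _ <= X]invf_div lef_pV2 // posrE; lra.
  split; first by lra.
  by rewrite ger0_norm; [nra | lra].
have S4 : 4 <= S by rewrite (ler_nat _ 4); lia.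
have [||x /andP[x1 x2] px] := @poly_ivt _ p S (2 * S).
- by lra.
- by rewrite !pE; apply/andP; split; nra.
exists x; first exact: rootE.
have x0 : 0 < x by lra.
have xV : x^-1 < 1 by rewrite invf_lt1 //; lra.
have xV0 : 0 < x^-1 by rewrite invr_gt0.
split; first by lra.
by rewrite ler0_norm; [nra | lra].
Qed.

Lemma even_chain : ~~ odd s -> exists r : R,
  max_modulus_root
    ('X^3 - (S * F) *: 'X^2 - ((S ^+ 2 - 3 * S + 1) * F ^+ 2) *: 'X
       - ((S - 1) * F ^+ 3)%:P) (real_complex R r)
  /\ calI (chain_graph (@v1 n) (@v2 n)) R @[n --> \oo] -->
     (r ^+ 2 * (S ^+ 2 / 2) * F + r * S * (S - 1) * (S - 3) * F ^+ 2
        + (3 * S ^+ 2 - 5 * S + 2) / 2 * F ^+ 3)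
     / (S / 2 * (r ^+ 2 * S * F + 2 * r * (S ^+ 2 - 3 * S + 1) * F ^+ 2
                 + 3 * (S - 1) * F ^+ 3)).
Proof.
move=> os; have S2 : 2 <= S by rewrite (ler_nat _ 2).
have F0 := F_gt0; have [x xE [x1 domx]] := even_root os.
have x0 : 0 < x by lra.
have xV0 : 0 < x^-1 by rewrite invr_gt0.
pose r := F * x; have r0 : 0 < r by exact: mulr_gt0.
have rE : r ^+ 3 = S * F * r ^+ 2 - (- ((S ^+ 2 - 3 * S + 1) * F ^+ 2)) * r
    + (S - 1) * F ^+ 3.
  by rewrite /r exprMn xE; ring.
have e1E : S * F - r = F * (S - x) by rewrite /r; ring.
have e3E : (S - 1) * F ^+ 3 / r = F ^+ 2 * ((S - 1) * x^-1).
  by rewrite /r; field; rewrite !gt_eqF.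
have dom : `|S * F - r| * r + `|(S - 1) * F ^+ 3 / r| < r ^+ 2.
  rewrite e1E e3E normrM (gtr0_norm F0).
  rewrite [`|F ^+ 2 * _|]ger0_norm; last first.
    by rewrite !mulr_ge0 ?invr_ge0 ?exprn_ge0 //; lra.
  have -> : F * `|S - x| * r + F ^+ 2 * ((S - 1) * x^-1) =
      F ^+ 2 * (`|S - x| * x + (S - 1) * x^-1) by rewrite /r; ring.
  by rewrite /r exprMn ltr_pM2l // exprn_gt0.
exists r; split.
  by rewrite -[X in _ - _ + X - _]scaleNr; exact: cubic_max_modulus_root.
have st n := even_step os n.
have c1 n : _ := let: And5 h _ _ _ _ := st n in h.
have c2 n : _ := let: And5 _ h _ _ _ := st n in h.
have c3 n : _ := let: And5 _ _ h _ _ := st n in h.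
have w1 n : _ := let: And5 _ _ _ h _ := st n in h.
have w2 n : _ := let: And5 _ _ _ _ (conj h _) := st n in h.
have w3 n : _ := let: And5 _ _ _ _ (conj _ h) := st n in h.
(* Derivatives at y = 1 of s F y^s, F^2 ((s-1) y^(2s) - s(s-2) y^(2s-2)) and (s-1) F^3 y^(3s-2). *)
apply: (calI_chain_cubic_cvg (g1 := S ^+ 2 * F)
  (g2 := - (2 * S * (S - 1) * (S - 3)) * F ^+ 2)
  (g3 := (3 * S ^+ 2 - 5 * S + 2) * F ^+ 3) r0 rE dom).
- by move=> n; rewrite !(c1, c2, c3); ring.
- by move=> n; rewrite !(c1, c2, c3, w1, w2, w3); ring.
- rewrite e1E e3E !(c1, c2, c3) /=.
  rewrite [ltRHS](_ : _ = F ^+ 2 * ((S - 1) * (S - 2 + x + x^-1))); last by ring.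
  by rewrite !mulr_gt0 ?exprn_gt0 //; lra.
- by field.
- by ring.
Qed.

End ChainLimit.

Theorem theorem8 (R : realType) (s : nat) (hs : (2 <= s)%N)
    (v1 v2 : forall n : nat, 'I_n -> 'I_s)
    (hv : forall (n : nat) (i : 'I_n), v1 n i != v2 n i) :
  let G := fun n : nat => chain_graph (v1 n) (v2 n) in
  let S : R := s%:R in
  let F : R := (f (s - 2))%:R in
  [/\ f 0 = 1%N,
      (forall m : nat, odd m -> f m = dfact m)
    & (forall m : nat, ~~ odd m -> (0 < m)%N -> f m = dfact (m - 1))]
  /\
  ((3 <= s)%N -> odd s ->
   exists r : R,
     max_modulus_root
       ('X^3 - ((S + 1) * F) *: 'X^2 + (S * F ^+ 2) *: 'X - (F ^+ 3)%:P)
       (real_complex R r)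
     /\ calI (G n) R @[n --> \oo] -->
        (r ^+ 2 * ((S ^+ 2 - 1) / 2) * F
           - r * (S ^+ 2 - S - 1) * F ^+ 2
           + (3 * (S - 1)) / 2 * F ^+ 3)
        / (S / 2 * (r ^+ 2 * (S + 1) * F - 2 * r * S * F ^+ 2 + 3 * F ^+ 3)))
  /\
  (~~ odd s ->
   exists r : R,
     max_modulus_root
       ('X^3 - (S * F) *: 'X^2 - ((S ^+ 2 - 3 * S + 1) * F ^+ 2) *: 'X
          - ((S - 1) * F ^+ 3)%:P)
       (real_complex R r)
     /\ calI (G n) R @[n --> \oo] -->
        (r ^+ 2 * (S ^+ 2 / 2) * F
           + r * S * (S - 1) * (S - 3) * F ^+ 2
           + (3 * S ^+ 2 - 5 * S + 2) / 2 * F ^+ 3)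
        / (S / 2 * (r ^+ 2 * S * F
                    + 2 * r * (S ^+ 2 - 3 * S + 1) * F ^+ 2
                    + 3 * (S - 1) * F ^+ 3))).
Proof.
move=> G S F; split; last split.
- by split; [rewrite fE | exact: f_odd | exact: f_even].
- by move=> s3 os; exact: odd_chain.
- by move=> os; exact: even_chain.
Qed.
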